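(* Let $G$ be a finite subgroup of $SU(2)$ that is binary (i.e. contains $-I$), with $G\neq\{\pm I\}$. Then the cross-product algebra $\Lambda(\mathbb C^2,G)$ is Morita equivalent to the zigzag algebra $A(\Gamma^{\mathrm{aff}})$ of the affine Dynkin diagram $\Gamma^{\mathrm{aff}}$ associated to $G$ by the McKay correspondence.
   Context: $G$ acts on $\mathbb C^2$ by the inclusion $G\subset SU(2)$. $\Lambda(\mathbb C^2,G)=\Lambda(\mathbb C^2)\otimes\mathbb C[G]$ with product $(a\otimes g)(b\otimes h)=a\,g(b)\otimes gh$, where $\Lambda(\mathbb C^2)$ is the exterior algebra. $\Gamma^{\mathrm{aff}}$ is the graph whose vertices $a$ correspond to the irreducible complex representations $V_a$ of $G$, with the number of edges connecting $a$ and $b$ equal to the multiplicity of $V_b$ in $\mathbb C^2\otimes V_a$ (by McKay this is an affine Dynkin diagram). Zigzag algebra of a connected graph $\Gamma$ with more than two vertices and no loops or multiple edges: the double $D\Gamma$ has the same vertices, with each edge replaced by two oppositely oriented edges; paths are written as lists $(a_1|\dots|a_k)$ of vertices; $A(\Gamma)$ is the path algebra of $D\Gamma$ over $\mathbb C$ modulo the two-sided ideal generated by $(a|b|c)$ for $a,b$ connected, $b,c$ connected, $a\neq c$, and $(a|b|a)-(a|c|a)$ whenever $a$ is connected to both $b$ and $c$. *)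

(* Defs.v *)
From HB Require Import structures.
From mathcomp Require Import monalg.
From mathcomp Require Import all_boot all_order all_algebra all_fingroup.
From mathcomp Require Import all_solvable all_field all_character.
From mathcomp Require Import finmap complex boolp reals ring.

Set Implicit Arguments.
Unset Strict Implicit.
Unset Printing Implicit Defensive.

Import Order.TTheory GRing.Theory Num.Theory.
Local Open Scope ring_scope.
Local Open Scope quotient_scope.

(* Lambda(K^2) is stored through its grading K (+) K^2 (+) Lambda^2(K^2), the
   top degree being identified with K by e_0 /\ e_1 |-> 1.  [ext2_sqr0] and
   [ext2_universal] say that this is the exterior algebra of K^2. *)
Definition ext2 (K : fieldType) : Type := (K * 'cV[K]_2 * K)%type.

Section Ext2.
Variable K : fieldType.
Implicit Types (x y z : ext2 K) (v w : 'cV[K]_2) (g h : 'M[K]_2).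

HB.instance Definition _ :=
  GRing.Lmodule.copy (ext2 K) (K^o * 'cV[K]_2 * K^o)%type.

Definition wedge2 v w : K := v 0 0 * w 1 0 - v 1 0 * w 0 0.

Definition ext2_one : ext2 K := (1, 0, 0).
Definition ext2_mul x y : ext2 K :=
  (x.1.1 * y.1.1,
   x.1.1 *: y.1.2 + y.1.1 *: x.1.2,
   x.1.1 * y.2 + x.2 * y.1.1 + wedge2 x.1.2 y.1.2).

Lemma ext2P x y : x.1.1 = y.1.1 -> x.1.2 = y.1.2 -> x.2 = y.2 -> x = y.
Proof. by case: x y => [[a v] p] [[b w] q] /= -> -> ->. Qed.

Lemma cV2P v w : v 0 0 = w 0 0 -> v 1 0 = w 1 0 -> v = w.
Proof.
move=> e0 e1; apply/matrixP=> i j; rewrite (ord1 j).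
have [->|->] // : i = 0 \/ i = 1.
by case: i => [[|[|//]] ?]; [left | right]; apply/val_inj.
Qed.

Lemma sum2 (V : nmodType) (F : 'I_2 -> V) : \sum_i F i = F 0 + F 1.
Proof.
by rewrite 2!big_ord_recl big_ord0 addr0; congr (_ + F _); apply/val_inj.
Qed.

Lemma det2 g : \det g = g 0 0 * g 1 1 - g 0 1 * g 1 0.
Proof.
rewrite (expand_det_row _ 0) sum2 /cofactor !det_mx11 !mxE.
have -> : lift (0 : 'I_2) (0 : 'I_1) = 1 by apply/val_inj.
have -> : lift (1 : 'I_2) (0 : 'I_1) = 0 by apply/val_inj.
by rewrite expr0 expr1 mul1r mulN1r mulrN.
Qed.

Lemma ext2_addE x y : x + y = (x.1.1 + y.1.1, x.1.2 + y.1.2, x.2 + y.2).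
Proof. by []. Qed.

Lemma ext2_scaleE (c : K) x : c *: x = (c * x.1.1, c *: x.1.2, c * x.2).
Proof. by []. Qed.

Fact ext2_mulA : associative ext2_mul.
Proof.
move=> [[a v] p] [[b w] q] [[c u] r]; apply: ext2P => /=; first by ring.
- by apply: cV2P; rewrite !mxE; ring.
- by rewrite /wedge2 !mxE; ring.
Qed.

Fact ext2_mul1x : left_id ext2_one ext2_mul.
Proof.
move=> [[a v] p]; apply: ext2P => /=; first by ring.
- by apply: cV2P; rewrite !mxE; ring.
- by rewrite /wedge2 !mxE; ring.
Qed.

Fact ext2_mulx1 : right_id ext2_one ext2_mul.
Proof.
move=> [[a v] p]; apply: ext2P => /=; first by ring.
- by apply: cV2P; rewrite !mxE; ring.
- by rewrite /wedge2 !mxE; ring.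
Qed.

Fact ext2_mulDl : left_distributive ext2_mul +%R.
Proof.
move=> [[a v] p] [[b w] q] [[c u] r]; rewrite !ext2_addE.
apply: ext2P => /=; first by ring.
- by apply: cV2P; rewrite !mxE; ring.
- by rewrite /wedge2 !mxE; ring.
Qed.

Fact ext2_mulDr : right_distributive ext2_mul +%R.
Proof.
move=> [[a v] p] [[b w] q] [[c u] r]; rewrite !ext2_addE.
apply: ext2P => /=; first by ring.
- by apply: cV2P; rewrite !mxE; ring.
- by rewrite /wedge2 !mxE; ring.
Qed.

Fact ext2_one_neq0 : ext2_one != 0.
Proof. by apply/eqP=> -[/eqP]; rewrite oner_eq0. Qed.

HB.instance Definition _ := GRing.Zmodule_isNzRing.Build (ext2 K)
  ext2_mulA ext2_mul1x ext2_mulx1 ext2_mulDl ext2_mulDr ext2_one_neq0.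

Lemma ext2_mulE x y : x * y = ext2_mul x y. Proof. by []. Qed.

Fact ext2_scaleAl (c : K) x y : c *: (x * y) = (c *: x) * y.
Proof.
case: x y => [[a v] p] [[b w] q]; rewrite !ext2_mulE !ext2_scaleE.
apply: ext2P => /=; first by ring.
- by apply: cV2P; rewrite !mxE; ring.
- by rewrite /wedge2 !mxE; ring.
Qed.
HB.instance Definition _ :=
  GRing.Lmodule_isLalgebra.Build K (ext2 K) ext2_scaleAl.

Fact ext2_scaleAr (c : K) x y : c *: (x * y) = x * (c *: y).
Proof.
case: x y => [[a v] p] [[b w] q]; rewrite !ext2_mulE !ext2_scaleE.
apply: ext2P => /=; first by ring.
- by apply: cV2P; rewrite !mxE; ring.
- by rewrite /wedge2 !mxE; ring.
Qed.
HB.instance Definition _ :=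
  GRing.Lalgebra_isAlgebra.Build K (ext2 K) ext2_scaleAr.

Definition ext2_gen v : ext2 K := (0, v, 0).

Lemma ext2_sqr0 v : ext2_gen v * ext2_gen v = 0.
Proof.
rewrite ext2_mulE; apply: ext2P; rewrite /= ?mul0r ?mulr0 ?addr0 ?add0r //.
- by rewrite !scale0r addr0.
- by rewrite /wedge2 mulrC subrr.
Qed.

Lemma ext2_universal (A : algType K) (f : {linear 'cV[K]_2 -> A}) :
    (forall v, f v * f v = 0) ->
  exists F : {lrmorphism ext2 K -> A},
    (forall v, F (ext2_gen v) = f v) /\
    (forall F' : {lrmorphism ext2 K -> A},
       (forall v, F' (ext2_gen v) = f v) -> F' =1 F).
Proof.
move=> f2; pose e (i : 'I_2) : 'cV[K]_2 := delta_mx i 0.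
pose t := f (e 0) * f (e 1).
have defv v : v = v 0 0 *: e 0 + v 1 0 *: e 1.
  by apply: cV2P; rewrite !mxE /=; ring.
have anti : f (e 1) * f (e 0) = - t.
  have := f2 (e 0 + e 1); rewrite linearD mulrDl !mulrDr !f2 add0r addr0.
  by rewrite /t => /eqP; rewrite addr_eq0 => /eqP->; rewrite opprK.
have ff v w : f v * f w = wedge2 v w *: t.
  rewrite {1}[v]defv {1}[w]defv !linearD !linearZ /= mulrDl !mulrDr.
  rewrite -!scalerAl -!scalerAr !f2 anti !scaler0 add0r addr0.
  by rewrite !scalerN !scalerA -scalerBl /wedge2.
have f0 v : f v * t = 0.
  rewrite [v]defv linearD !linearZ /= mulrDl -!scalerAl.
  rewrite [f (e 0) * t]mulrA f2 mul0r [f (e 1) * t]mulrA anti mulNr -mulrA f2.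
  by rewrite mulr0 oppr0 !scaler0 addr0.
have t0 v : t * f v = 0.
  by rewrite {1}/t -mulrA ff -scalerAr f0 scaler0.
have tt : t * t = 0 by rewrite {1}/t -mulrA f0 mulr0.
pose F x := x.1.1 *: (1 : A) + f x.1.2 + x.2 *: t.
have Flin : linear F.
  move=> c x y; rewrite /F ext2_scaleE ext2_addE /= linearP.
  rewrite !scalerDl !scalerDr !scalerA.
  by rewrite [X in X + _]addrACA [LHS]addrACA.
have Fmul : monoid_morphism F.
  split=> [|x y]; first by rewrite /F /= scale1r scale0r raddf0 !addr0.
  rewrite /F ext2_mulE /= linearD !linearZ /= !mulrDl !mulrDr.
  rewrite -!scalerAl -!scalerAr !mul1r !mulr1 ff f0 t0 tt !scaler0 !addr0.
  set w := wedge2 _ _; rewrite !scalerDl !scalerA.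
  by rewrite [LHS](AC ((1*2)*(2*1)) (1*2*4*(3*6)*5))%AC.
pose Fsemi := GRing.isSemilinear.Build K (ext2 K) A _ F
  (GRing.semilinear_linear Flin).
pose Fm := GRing.isMonoidMorphism.Build (ext2 K) A F Fmul.
pose F' : {lrmorphism ext2 K -> A} := HB.pack F Fsemi Fm.
exists F'; split=> [v|F2 F2f x].
  by rewrite /= /F /= !scale0r add0r addr0.
have genE : x = x.1.1 *: 1 + ext2_gen x.1.2
                + x.2 *: (ext2_gen (e 0) * ext2_gen (e 1)).
  rewrite ext2_mulE !ext2_scaleE !ext2_addE; apply: ext2P => /=.
  - by ring.
  - by apply: cV2P; rewrite !mxE; ring.
  - by rewrite /wedge2 !mxE /=; ring.
by rewrite {1}genE !linearD !linearZ rmorphM rmorph1 /= !F2f.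
Qed.

(* A matrix acts on column vectors on the left, and on Lambda(K^2) by the
   induced algebra endomorphism ([ext2_actM], [ext2_act_gen]). *)
Definition ext2_act g x : ext2 K := (x.1.1, g *m x.1.2, \det g * x.2).

Lemma ext2_act_gen g v : ext2_act g (ext2_gen v) = ext2_gen (g *m v).
Proof. by rewrite /ext2_act /= mulr0. Qed.

Lemma ext2_act1 x : ext2_act 1%:M x = x.
Proof. by apply: ext2P; rewrite /= ?mul1mx ?det1 ?mul1r. Qed.

Lemma ext2_act_comp g h x : ext2_act (g *m h) x = ext2_act g (ext2_act h x).
Proof. by apply: ext2P; rewrite /= ?mulmxA ?det_mulmx ?mulrA. Qed.

Fact ext2_act_linear g : linear (ext2_act g).
Proof.
move=> c x y; rewrite !ext2_scaleE !ext2_addE; apply: ext2P => //=.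
- by rewrite mulmxDr scalemxAr.
- by ring.
Qed.
HB.instance Definition _ g := GRing.isSemilinear.Build K (ext2 K) (ext2 K) _
  (ext2_act g) (GRing.semilinear_linear (ext2_act_linear g)).

Fact ext2_actM g : monoid_morphism (ext2_act g).
Proof.
split=> [|x y]; first by apply: ext2P; rewrite /= ?mulmx0 ?mulr0.
rewrite !ext2_mulE; apply: ext2P => //=; first by rewrite mulmxDr -!scalemxAr.
by rewrite det2 /wedge2 !mxE !sum2; ring.
Qed.
HB.instance Definition _ g := GRing.isMonoidMorphism.Build (ext2 K) (ext2 K)
  (ext2_act g) (ext2_actM g).
End Ext2.

(* [f : crossed rG] stands for the sum of the (f g) (x) g in
   Lambda(K^2) (x) K[G]. *)
Definition crossed (K : fieldType) (gT : finGroupType)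
    (rG : mx_representation K [set: gT] 2) : Type := {ffun gT -> ext2 K}.

Section Crossed.
Variables (K : fieldType) (gT : finGroupType).
Variable rG : mx_representation K [set: gT] 2.
Implicit Types (x y z : crossed rG) (a b : ext2 K) (g h : gT).

HB.instance Definition _ :=
  GRing.Lmodule.copy (crossed rG) {ffun gT -> ext2 K}.

Definition crossed_tens a g : crossed rG := [ffun k => if k == g then a else 0].

Definition crossed_one : crossed rG := crossed_tens 1 1%g.
Definition crossed_mul x y : crossed rG :=
  [ffun k => \sum_(h : gT) x h * ext2_act (rG h) (y (h^-1 * k)%g)].

Lemma crossedDE x y g : (x + y) g = x g + y g.
Proof. by rewrite ffunE. Qed.

Lemma crossedZE (c : K) x g : (c *: x) g = c *: x g.
Proof. by rewrite ffunE. Qed.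

Lemma crossed_tensM a b g h :
  crossed_mul (crossed_tens a g) (crossed_tens b h)
  = crossed_tens (a * ext2_act (rG g) b) (g * h)%g.
Proof.
apply/ffunP=> k; rewrite !ffunE (bigD1 g) //= big1 => [|l /negPf nlg].
  rewrite !ffunE eqxx addr0 -(inj_eq (mulgI g)) mulKVg.
  by case: eqP => // _; rewrite raddf0 mulr0.
by rewrite !ffunE nlg mul0r.
Qed.

Fact crossed_mulA : associative crossed_mul.
Proof.
move=> x y z; apply/ffunP=> k; rewrite !ffunE.
under eq_bigr => h _ do rewrite ffunE raddf_sum mulr_sumr.
under [RHS]eq_bigr => h _ do rewrite ffunE mulr_suml.
rewrite [RHS]exchange_big /=; apply: eq_bigr => h _.
rewrite [RHS](reindex_inj (mulgI h)) /=; apply: eq_bigr => l _.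
rewrite mulKg repr_mxM ?inE // ext2_act_comp invMg mulgA.
by rewrite [ext2_act (rG h) (_ * _)]rmorphM mulrA.
Qed.

Fact crossed_mul1x : left_id crossed_one crossed_mul.
Proof.
move=> x; apply/ffunP=> k; rewrite !ffunE (bigD1 1%g) //= big1 => [|l /negPf nl].
  by rewrite ffunE eqxx mul1r repr_mx1 ext2_act1 addr0 invg1 mul1g.
by rewrite ffunE nl mul0r.
Qed.

Fact crossed_mulx1 : right_id crossed_one crossed_mul.
Proof.
move=> x; apply/ffunP=> k; rewrite !ffunE (bigD1 k) //= big1 => [|l nl].
  by rewrite ffunE mulVg eqxx rmorph1 mulr1 addr0.
rewrite ffunE -(inj_eq (mulgI l)) mulKVg mulg1 eq_sym (negPf nl).
by rewrite raddf0 mulr0.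
Qed.

Fact crossed_mulDl : left_distributive crossed_mul +%R.
Proof.
move=> x y z; apply/ffunP=> k; rewrite !ffunE -big_split /=.
by apply: eq_bigr => h _; rewrite crossedDE mulrDl.
Qed.

Fact crossed_mulDr : right_distributive crossed_mul +%R.
Proof.
move=> x y z; apply/ffunP=> k; rewrite !ffunE -big_split /=.
by apply: eq_bigr => h _; rewrite crossedDE raddfD mulrDr.
Qed.

Fact crossed_one_neq0 : crossed_one != 0.
Proof.
apply/eqP=> /ffunP/(_ 1%g); rewrite !ffunE eqxx.
by apply/eqP; rewrite oner_neq0.
Qed.

HB.instance Definition _ := GRing.Zmodule_isNzRing.Build (crossed rG)
  crossed_mulA crossed_mul1x crossed_mulx1 crossed_mulDl crossed_mulDr
  crossed_one_neq0.

Fact crossed_scaleAl (c : K) x y : c *: (x * y) = (c *: x) * y.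
Proof.
apply/ffunP=> k; rewrite crossedZE !ffunE scaler_sumr.
by apply: eq_bigr => h _; rewrite crossedZE scalerAl.
Qed.
HB.instance Definition _ :=
  GRing.Lmodule_isLalgebra.Build K (crossed rG) crossed_scaleAl.

Fact crossed_scaleAr (c : K) x y : c *: (x * y) = x * (c *: y).
Proof.
apply/ffunP=> k; rewrite crossedZE !ffunE scaler_sumr.
by apply: eq_bigr => h _; rewrite crossedZE linearZ scalerAr.
Qed.
HB.instance Definition _ :=
  GRing.Lalgebra_isAlgebra.Build K (crossed rG) crossed_scaleAr.
End Crossed.

Section Ideals.
Variables (K : fieldType) (A : algType K).

Record two_sided_ideal (J : A -> Prop) : Prop := TwoSidedIdeal {
  ideal0 : J 0;
  idealD : forall x y, J x -> J y -> J (x + y);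
  idealMl : forall a x, J x -> J (a * x);
  idealMr : forall a x, J x -> J (x * a)
}.

Definition ideal_gen (S : A -> Prop) (x : A) : Prop :=
  forall J, two_sided_ideal J -> (forall s, S s -> J s) -> J x.

Lemma ideal_gen_ideal S : two_sided_ideal (ideal_gen S).
Proof.
split=> [J idJ _|x y Sx Sy J idJ SJ|a x Sx J idJ SJ|a x Sx J idJ SJ].
- exact: ideal0 idJ.
- by apply: (idealD idJ); [apply: Sx | apply: Sy].
- by apply: (idealMl idJ); apply: Sx.
- by apply: (idealMr idJ); apply: Sx.
Qed.

Record proper_two_sided_ideal := ProperTwoSidedIdeal {
  ideal_set :> A -> Prop;
  ideal_two_sided : two_sided_ideal ideal_set;
  ideal_proper : ~ ideal_set 1
}.
End Ideals.

Section QuotientAlgebra.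
Variables (K : fieldType) (A : algType K) (J : proper_two_sided_ideal A).

Definition ideal_pred : {pred A} := fun x => `[< J x >].

Fact ideal_pred_zmod : zmod_closed ideal_pred.
Proof.
have idJ := ideal_two_sided J; split=> [|x y /asboolP Jx /asboolP Jy].
  by apply/asboolP; apply: ideal0 idJ.
apply/asboolP; apply: (idealD idJ) => //.
by rewrite -mulN1r; apply: (idealMl idJ).
Qed.
HB.instance Definition _ := GRing.isZmodClosed.Build A ideal_pred
  ideal_pred_zmod.

Definition quot_alg : Type := Quotient.quot ideal_pred.

HB.instance Definition _ := GRing.Zmodule.on quot_alg.

Definition quot_proj (x : A) : quot_alg := \pi_(Quotient.quot ideal_pred) x.

Lemma quot_projP x y : quot_proj x = quot_proj y <-> J (x - y).
Proof.
rewrite /quot_proj; split=> [/eqP|Jxy]; first by rewrite -Quotient.idealrBE => /asboolP.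
by apply/eqP; rewrite -Quotient.idealrBE; apply/asboolP.
Qed.

Lemma quot_projD x y : quot_proj (x + y) = quot_proj x + quot_proj y.
Proof. exact: (Quotient.pi_add ideal_pred). Qed.

Definition quot_repr (u : quot_alg) : A :=
  generic_quotient.repr (u : Quotient.quot ideal_pred).

Lemma quot_reprK : cancel quot_repr quot_proj.
Proof. exact: reprK. Qed.

Lemma quot_projK x : J (quot_repr (quot_proj x) - x).
Proof. by apply/quot_projP; rewrite quot_reprK. Qed.

Definition quot_mul (u v : quot_alg) : quot_alg :=
  quot_proj (quot_repr u * quot_repr v).
Definition quot_scale (c : K) (u : quot_alg) : quot_alg :=
  quot_proj (c *: quot_repr u).

Lemma quot_projM x y : quot_proj (x * y) = quot_mul (quot_proj x) (quot_proj y).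
Proof.
have idJ := ideal_two_sided J.
apply/esym/quot_projP; set x' := quot_repr _; set y' := quot_repr _.
have -> : x' * y' - x * y = (x' - x) * y' + x * (y' - y).
  by rewrite mulrBl mulrBr addrA subrK.
apply: (idealD idJ); [apply: (idealMr idJ) | apply: (idealMl idJ)];
  exact: quot_projK.
Qed.

Lemma quot_projZ (c : K) x : quot_proj (c *: x) = quot_scale c (quot_proj x).
Proof.
apply/esym/quot_projP; rewrite -scalerBr -[_ - x]mul1r scalerAl.
exact/(idealMl (ideal_two_sided J))/quot_projK.
Qed.

Fact quot_mulA : associative quot_mul.
Proof.
move=> u v w; rewrite -[u]quot_reprK -[v]quot_reprK -[w]quot_reprK.
by rewrite -!quot_projM mulrA.
Qed.
Fact quot_mul1x : left_id (quot_proj 1) quot_mul.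
Proof. by move=> u; rewrite -[u]quot_reprK -quot_projM mul1r. Qed.
Fact quot_mulx1 : right_id (quot_proj 1) quot_mul.
Proof. by move=> u; rewrite -[u]quot_reprK -quot_projM mulr1. Qed.
Fact quot_mulDl : left_distributive quot_mul +%R.
Proof.
move=> u v w; rewrite -[u]quot_reprK -[v]quot_reprK -[w]quot_reprK.
by rewrite -quot_projD -!quot_projM -quot_projD mulrDl.
Qed.
Fact quot_mulDr : right_distributive quot_mul +%R.
Proof.
move=> u v w; rewrite -[u]quot_reprK -[v]quot_reprK -[w]quot_reprK.
by rewrite -quot_projD -!quot_projM -quot_projD mulrDr.
Qed.
Fact quot_one_neq0 : quot_proj 1 != 0.
Proof.
have -> : 0 = quot_proj 0 by exact/esym/(@pi_zeror _ _ _ _ _ (Quotient.quot ideal_pred)).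
by apply/eqP=> /quot_projP; rewrite subr0; apply: ideal_proper.
Qed.
HB.instance Definition _ := GRing.Zmodule_isNzRing.Build quot_alg
  quot_mulA quot_mul1x quot_mulx1 quot_mulDl quot_mulDr quot_one_neq0.

Fact quot_scaleA (c d : K) u :
  quot_scale c (quot_scale d u) = quot_scale (c * d) u.
Proof. by rewrite -[u]quot_reprK -!quot_projZ scalerA. Qed.
Fact quot_scale1 : left_id 1 quot_scale.
Proof. by move=> u; rewrite -[u]quot_reprK -!quot_projZ scale1r. Qed.
Fact quot_scaleDr : right_distributive quot_scale +%R.
Proof.
move=> c u v; rewrite -[u]quot_reprK -[v]quot_reprK.
by rewrite -quot_projD -!quot_projZ -quot_projD scalerDr.
Qed.
Fact quot_scaleDl u : {morph quot_scale^~ u : c d / c + d}.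
Proof.
by move=> c d; rewrite -[u]quot_reprK -!quot_projZ -quot_projD scalerDl.
Qed.
HB.instance Definition _ := GRing.Zmodule_isLmodule.Build K quot_alg
  quot_scaleA quot_scale1 quot_scaleDr quot_scaleDl.

Lemma quot_projME x y : quot_proj (x * y) = quot_proj x * quot_proj y.
Proof. exact: quot_projM. Qed.
Lemma quot_projZE (c : K) x : quot_proj (c *: x) = c *: quot_proj x.
Proof. exact: quot_projZ. Qed.

Fact quot_scaleAl (c : K) (u v : quot_alg) : c *: (u * v) = (c *: u) * v.
Proof.
rewrite -[u]quot_reprK -[v]quot_reprK.
by rewrite -!(quot_projME, quot_projZE) scalerAl.
Qed.
HB.instance Definition _ :=
  GRing.Lmodule_isLalgebra.Build K quot_alg quot_scaleAl.

Fact quot_scaleAr (c : K) (u v : quot_alg) : c *: (u * v) = u * (c *: v).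
Proof.
rewrite -[u]quot_reprK -[v]quot_reprK.
by rewrite -!(quot_projME, quot_projZE) scalerAr.
Qed.
HB.instance Definition _ :=
  GRing.Lalgebra_isAlgebra.Build K quot_alg quot_scaleAr.
End QuotientAlgebra.

(* [m a b] is the number of edges connecting a and b. *)
Record zigzag_admissible (V : finType) (m : V -> V -> nat) : Prop := {
  edges_sym : forall a b, m a b = m b a;
  no_loops : forall a, m a a = 0%N;
  no_multiple_edges : forall a b, (m a b <= 1)%N;
  graph_connected : forall a b, connect (fun x y => (0 < m x y)%N) a b;
  more_than_two_vertices : (2 < #|V|)%N
}.

Structure zigzag_graph := ZigzagGraph {
  vertex : finType;
  edges : vertex -> vertex -> nat;
  zigzag_graphP : zigzag_admissible edges
}.

Definition adjacent (Gm : zigzag_graph) : rel (vertex Gm) :=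
  fun a b => (0 < edges a b)%N.

Section PathAlgebra.
Variables (K : fieldType) (Gm : zigzag_graph).
Local Notation V := (vertex Gm).

(* The path (a_1|...|a_k), k >= 1, of the double of the graph is the sequence
   of its vertices; the one-vertex paths (a) are the trivial ones. *)
Definition is_path (p : seq V) : bool :=
  if p is a :: s then path (@adjacent Gm) a s else false.

Definition gpath : Type := {p : seq V | is_path p}.
HB.instance Definition _ := Choice.on gpath.

Definition path_algebra : Type := {malg K[gpath]}.
HB.instance Definition _ := GRing.Lmodule.on path_algebra.

(* The basis element of a path; sequences that are not paths are sent to 0. *)
Definition pth (p : seq V) : path_algebra :=
  if insub p : option gpath is Some q then << q >> else 0.

(* (a_1|...|a_k)(b_1|...|b_l) is (a_1|...|a_k|b_2|...|b_l) if a_k = b_1 and 0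
   otherwise, the latter being encoded by the empty sequence. *)
Definition path_cat (p q : seq V) : seq V :=
  match p, q with
  | a :: s, b :: t => if last a s == b then a :: s ++ t else [::]
  | _, _ => [::]
  end.

Definition path_one : path_algebra := \sum_(a : V) pth [:: a].
Definition path_mul (x y : path_algebra) : path_algebra :=
  \sum_(p <- msupp x) \sum_(q <- msupp y)
    (x@_p * y@_q) *: pth (path_cat (val p) (val q)).

Lemma path_catA : associative path_cat.
Proof.
move=> [|a s] [|b t] [|c u] //=; try by case: ifP.
case: (last a s =P b) => [eb|neb] /=; case: (last b t =P c) => ec //=.
- by rewrite eb eqxx last_cat eb ec eqxx catA.
- by rewrite last_cat eb; case: (last b t =P c).
- by case: (last a s =P b).
Qed.

Lemma is_path_cat p q : path_cat p q != [::] ->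
  is_path (path_cat p q) = is_path p && is_path q.
Proof.
case: p q => [|a s] [|b t] //=; case: (last a s =P b) => //= <- _.
by rewrite cat_path.
Qed.

Lemma pth0 p : ~~ is_path p -> pth p = 0.
Proof. by move=> np; rewrite /pth insubN. Qed.

Lemma pth_val (p : gpath) : pth (val p) = << p >>.
Proof. by rewrite /pth valK. Qed.

Lemma pth_catN p q : ~~ is_path p || ~~ is_path q -> pth (path_cat p q) = 0.
Proof.
rewrite -negb_and => npq; apply: pth0.
by have [->|nz] := eqVneq (path_cat p q) [::]; last rewrite is_path_cat.
Qed.

Definition lin_ext (W : lmodType K) (f : gpath -> W) (x : path_algebra) : W :=
  \sum_(p <- msupp x) x@_p *: f p.

Lemma lin_extEw (W : lmodType K) (f : gpath -> W) (x : path_algebra)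
    (d : {fset gpath}) :
  (msupp x `<=` d)%fset -> lin_ext f x = \sum_(p <- d) x@_p *: f p.
Proof.
move=> le; rewrite /lin_ext; apply: big_fset_incl => // p _ /mcoeff_outdom ->.
by rewrite scale0r.
Qed.

Lemma lin_ext_linear (W : lmodType K) (f : gpath -> W) : linear (lin_ext f).
Proof.
move=> c x y.
pose d := (msupp x `|` msupp y `|` msupp (c *: x + y : {malg K[gpath]}))%fset.
rewrite (@lin_extEw _ _ x d) ?(@lin_extEw _ _ y d) ?(@lin_extEw _ _ _ d) /d.
- rewrite scaler_sumr -big_split /=; apply: eq_bigr => p _.
  by rewrite scalerA -scalerDl mcoeffD mcoeffZ.
- by rewrite fsubsetUr.
- by rewrite -fsetUA fsubsetU // fsubsetUl orbT.
- by rewrite -fsetUA fsubsetUl.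
Qed.
HB.instance Definition _ (W : lmodType K) (f : gpath -> W) :=
  GRing.isSemilinear.Build K path_algebra W _ (lin_ext f)
    (GRing.semilinear_linear (lin_ext_linear f)).

Lemma lin_ext1 (W : lmodType K) (f : gpath -> W) p :
  lin_ext f (<< p >> : {malg K[gpath]}) = f p.
Proof.
rewrite (@lin_extEw _ _ _ [fset p]%fset) ?msuppU_le //.
by rewrite big_seq_fset1 mcoeffUU scale1r.
Qed.

Lemma path_algebra_ind (P : path_algebra -> Prop) :
  (forall p, P << p >>) -> P 0 -> (forall c x y, P x -> P y -> P (c *: x + y)) ->
  forall x, P x.
Proof.
move=> Pp P0 PD x; rewrite [x]monalgE; elim/big_rec: _ => // p y _ Py.
have -> : << x@_p *g p >> = x@_p *: << p >> :> {malg K[gpath]}.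
  by apply/malgP=> q; rewrite mcoeffZ !mcoeffU mulrnAr mulr1.
exact: PD.
Qed.

Lemma path_mulE x y : path_mul x y =
  lin_ext (fun p => lin_ext (fun q => pth (path_cat (val p) (val q))) y) x.
Proof.
apply: eq_bigr => p _; rewrite scaler_sumr; apply: eq_bigr => q _.
by rewrite scalerA.
Qed.

Lemma path_mulPl c x y z :
  path_mul (c *: x + y) z = c *: path_mul x z + path_mul y z.
Proof. by rewrite !path_mulE linearP. Qed.

Lemma path_mulPr c x y z :
  path_mul z (c *: x + y) = c *: path_mul z x + path_mul z y.
Proof.
rewrite !path_mulE ![lin_ext _ z]/lin_ext scaler_sumr -big_split /=.
by apply: eq_bigr => p _; rewrite linearP scalerDr !scalerA mulrC.
Qed.

Lemma path_mul0l x : path_mul 0 x = 0.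
Proof. by rewrite path_mulE linear0. Qed.

Lemma path_mul0r x : path_mul x 0 = 0.
Proof.
by rewrite path_mulE /lin_ext big1 // => p _; rewrite msupp0 big_seq_fset0 scaler0.
Qed.

Lemma path_mul_pth p q : path_mul (pth p) (pth q) = pth (path_cat p q).
Proof.
have [ip|np] := boolP (is_path p); last first.
  by rewrite (pth0 np) path_mul0l pth_catN ?np.
have [iq|nq] := boolP (is_path q); last first.
  by rewrite (pth0 nq) path_mul0r pth_catN ?nq ?orbT.
by rewrite -[p]/(val (Sub p ip : gpath)) -[q]/(val (Sub q iq : gpath)) !pth_val
  path_mulE !lin_ext1.
Qed.

Fact path_mulA : associative path_mul.
Proof.
elim/path_algebra_ind => [p|y z|c x x' IHx IHx' y z]; last 2 first.
- by rewrite !path_mul0l.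
- by rewrite !path_mulPl IHx IHx'.
elim/path_algebra_ind => [q|z|c y y' IHy IHy' z]; last 2 first.
- by rewrite path_mul0l path_mul0r path_mul0l.
- by rewrite path_mulPl !path_mulPr path_mulPl IHy IHy'.
elim/path_algebra_ind => [r||c z z' IHz IHz']; last 2 first.
- by rewrite !path_mul0r.
- by rewrite !path_mulPr IHz IHz'.
by rewrite -!pth_val !path_mul_pth path_catA.
Qed.

Fact path_mulDl : left_distributive path_mul +%R.
Proof. by move=> x y z; rewrite -[x]scale1r path_mulPl !scale1r. Qed.

Fact path_mulDr : right_distributive path_mul +%R.
Proof. by move=> x y z; rewrite -[y]scale1r path_mulPr !scale1r. Qed.

Lemma path_mul_suml (I : Type) (r : seq I) (F : I -> path_algebra) x :
  path_mul (\sum_(i <- r) F i) x = \sum_(i <- r) path_mul (F i) x.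
Proof.
by apply: (big_morph (path_mul^~ x)) => [y z|]; rewrite ?path_mulDl ?path_mul0l.
Qed.

Lemma path_mul_sumr (I : Type) (r : seq I) (F : I -> path_algebra) x :
  path_mul x (\sum_(i <- r) F i) = \sum_(i <- r) path_mul x (F i).
Proof.
by apply: (big_morph (path_mul x)) => [y z|]; rewrite ?path_mulDr ?path_mul0r.
Qed.

Fact path_mul1x : left_id path_one path_mul.
Proof.
elim/path_algebra_ind => [p||c x y IHx IHy]; last 2 first.
- exact: path_mul0r.
- by rewrite path_mulPr IHx IHy.
rewrite -pth_val path_mul_suml; case: p => -[|a s] //= ps.
rewrite (bigD1 a) //= path_mul_pth /= eqxx big1 ?addr0 // => b /negPf nba.
by rewrite path_mul_pth /= nba pth0.
Qed.

Fact path_mulx1 : right_id path_one path_mul.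
Proof.
elim/path_algebra_ind => [p||c x y IHx IHy]; last 2 first.
- exact: path_mul0l.
- by rewrite path_mulPl IHx IHy.
rewrite -pth_val path_mul_sumr; case: p => -[|a s] //= ps.
rewrite (bigD1 (last a s)) //= path_mul_pth /= eqxx cats0.
rewrite big1 ?addr0 // => b; rewrite eq_sym => /negPf nba.
by rewrite path_mul_pth /= nba pth0.
Qed.

Definition trivial_path (a : V) : gpath := Sub [:: a] isT.

Lemma mcoeff_pth p (r : gpath) : (pth p)@_r = (p == val r)%:R.
Proof.
rewrite /pth; case: insubP => [q _ <-|np]; first by rewrite mcoeffU val_eqE.
rewrite mcoeff0; case: eqP => // epr.
by move: np; rewrite epr (valP r).
Qed.

Lemma mcoeff_path_mul a x y : (path_mul x y)@_(trivial_path a)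
  = x@_(trivial_path a) * y@_(trivial_path a).
Proof.
elim/path_algebra_ind: x => [p||c x x' IHx IHx']; last 2 first.
- by rewrite path_mul0l !mcoeff0 mul0r.
- by rewrite path_mulPl !mcoeffD !mcoeffZ IHx IHx' mulrDl mulrA.
elim/path_algebra_ind: y => [q||c y y' IHy IHy']; last 2 first.
- by rewrite path_mul0r !mcoeff0 mulr0.
- by rewrite path_mulPr !mcoeffD !mcoeffZ IHy IHy' mulrDr mulrCA.
rewrite -!pth_val path_mul_pth !mcoeff_pth -natrM mulnb; congr (_%:R).
congr (nat_of_bool _); case: p q => -[|b s] //= _ [[|c t] //= _].
case: (last b s =P c) => [<-|nbc].
  by case: s => [|d s]; case: t => [|e t];
    rewrite ?eqseq_cons ?andbT ?andbF ?andbb //= andbC.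
case: s nbc => [|d s]; case: t => [|e t] //=;
  rewrite ?eqseq_cons ?andbT ?andbF //.
by case: (b =P a) => // ->; case: (c =P a) => // ->.
Qed.

Lemma mcoeff_path_one a : path_one@_(trivial_path a) = 1.
Proof.
rewrite /path_one raddf_sum (bigD1 a) //= mcoeff_pth eqxx big1 ?addr0 //.
by move=> b nba; rewrite mcoeff_pth eqseq_cons (negPf nba).
Qed.

Lemma graph_vertex : exists a : V, true.
Proof.
have := more_than_two_vertices (zigzag_graphP Gm).
by move=> V2; have /card_gt0P[a _] := ltnW (ltnW V2); exists a.
Qed.

Fact path_one_neq0 : path_one != 0.
Proof.
have [a _] := graph_vertex; apply/eqP=> /(congr1 (mcoeff (trivial_path a))).
by rewrite mcoeff_path_one mcoeff0; apply/eqP/oner_neq0.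
Qed.

HB.instance Definition _ := GRing.Zmodule_isNzRing.Build path_algebra
  path_mulA path_mul1x path_mulx1 path_mulDl path_mulDr path_one_neq0.

Fact path_scaleAl (c : K) (x y : path_algebra) : c *: (x * y) = (c *: x) * y.
Proof.
by have := path_mulPl c x 0 y; rewrite path_mul0l !addr0 => ?; apply: esym.
Qed.
HB.instance Definition _ :=
  GRing.Lmodule_isLalgebra.Build K path_algebra path_scaleAl.

Fact path_scaleAr (c : K) (x y : path_algebra) : c *: (x * y) = x * (c *: y).
Proof.
by have := path_mulPr c y 0 x; rewrite path_mul0r !addr0 => ?; apply: esym.
Qed.
HB.instance Definition _ :=
  GRing.Lalgebra_isAlgebra.Build K path_algebra path_scaleAr.

Inductive zigzag_rel : path_algebra -> Prop :=
| zigzag_rel_straight (a b c : V) : adjacent a b -> adjacent b c -> a != c ->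
    zigzag_rel (pth [:: a; b; c])
| zigzag_rel_back (a b c : V) : adjacent a b -> adjacent a c ->
    zigzag_rel (pth [:: a; b; a] - pth [:: a; c; a]).

Fact zigzag_proper : ~ ideal_gen zigzag_rel 1.
Proof.
have [a _] := graph_vertex.
move=> /(_ (fun x => x@_(trivial_path a) = 0)) H.
have /eqP : (1 : path_algebra)@_(trivial_path a) = 0.
  apply: H => [|_ [b c d _ _ _|b c d _ _]]; last 2 first.
  - by rewrite mcoeff_pth eqseq_cons andbF.
  - by rewrite mcoeffB !mcoeff_pth !eqseq_cons !andbF subrr.
  split=> [|x y x0 y0|x y y0|x y x0]; first exact: mcoeff0.
  - by rewrite mcoeffD x0 y0 addr0.
  - by rewrite mcoeff_path_mul y0 mulr0.
  - by rewrite mcoeff_path_mul x0 mul0r.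
by rewrite mcoeff_path_one oner_eq0.
Qed.

Definition zigzag_ideal : proper_two_sided_ideal path_algebra :=
  ProperTwoSidedIdeal (ideal_gen_ideal zigzag_rel) zigzag_proper.

Definition zigzag_algebra : algType K := quot_alg zigzag_ideal.
End PathAlgebra.

Section Morita.
Variable K : fieldType.

(* K-linear functors from left A-modules to left B-modules; a scalar c : K acts
   on modules through its images c%:A in A and in B.  With c = 0, resp.
   c = 1, [fmap_linear] says that fmap respects pointwise equality, resp. sums. *)
Record linear_functor (A B : algType K) := LinearFunctor {
  fobj :> lmodType A -> lmodType B;
  fmap : forall M N : lmodType A, {linear M -> N} -> {linear fobj M -> fobj N};
  fmap_id : forall M : lmodType A, fmap (idfun : {linear M -> M}) =1 id;
  fmap_comp : forall (M N P : lmodType A)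
      (g : {linear N -> P}) (f : {linear M -> N}),
    fmap (g \o f : {linear M -> P}) =1 fmap g \o fmap f;
  fmap_linear : forall (M N : lmodType A) (c : K) (f g h : {linear M -> N}),
    (forall x, h x = c%:A *: f x + g x) ->
    forall y, fmap h y = c%:A *: fmap f y + fmap g y
}.

(* An equivalence of module categories: [eta] and [eps] are natural isomorphisms
   from the identity functors to G o F and to F o G. *)
Definition morita_equivalent (A B : algType K) : Prop :=
  exists (F : linear_functor A B) (G : linear_functor B A)
    (eta : forall M : lmodType A, {linear M -> G (F M)})
    (eps : forall N : lmodType B, {linear N -> F (G N)}),
  [/\ forall M, bijective (eta M),
      forall N, bijective (eps N),
      forall (M M' : lmodType A) (f : {linear M -> M'}),
        eta M' \o f =1 fmap G (fmap F f) \o eta M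
    & forall (N N' : lmodType B) (f : {linear N -> N'}),
        eps N' \o f =1 fmap F (fmap G f) \o eps N].
End Morita.

Section McKay.
Variables (K : decFieldType) (gT : finGroupType) (G : {group gT}).
Variable sG : irrType K G.

(* The multiplicity of the irreducible representation [irr_repr i] in [rW]:
   [DecSocleType rW] lists the isotypic components W of rW, whose irreducible
   constituent [socle_repr W] has index [irr_comp sG (socle_repr W)] and occurs
   [socle_mult W] times. *)
Definition irr_mult n (rW : mx_representation K G n) (i : sG) : nat :=
  if [pick W : DecSocleType rW | irr_comp sG (socle_repr W) == i] is Some W
  then socle_mult W else 0%N.

Definition mckay_edges n (rV : mx_representation K G n) (a b : sG) : nat :=
  irr_mult (prod_repr rV (irr_repr a)) b.
End McKay.

Section SU2.
Variable R : realType.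
Local Notation C := R[i].

Definition in_SU2 (A : 'M[C]_2) : Prop := A \is unitarymx /\ \det A = 1.

Record SU2_finite_subgroup := SU2FiniteSubgroup {
  SU2_elts :> {fset 'M[C]_2};
  SU2_eltsP : forall A, A \in SU2_elts -> in_SU2 A;
  SU2_elts1 : 1%:M \in SU2_elts;
  SU2_eltsM : forall A B, A \in SU2_elts -> B \in SU2_elts ->
    A *m B \in SU2_elts;
  SU2_eltsV : forall A, A \in SU2_elts -> invmx A \in SU2_elts
}.

Variable G : SU2_finite_subgroup.

Definition SU2_group : Type := SU2_elts G.
HB.instance Definition _ := Finite.on SU2_group.

Implicit Types g h : SU2_group.

Definition SU2_mul g h : SU2_group := FSetSub (SU2_eltsM (valP g) (valP h)).
Definition SU2_one : SU2_group := FSetSub (SU2_elts1 G).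
Definition SU2_inv g : SU2_group := FSetSub (SU2_eltsV (valP g)).

Fact SU2_mulA : associative SU2_mul.
Proof. by move=> g h k; apply/val_inj; apply: mulmxA. Qed.
Fact SU2_mul1g : left_id SU2_one SU2_mul.
Proof. by move=> g; apply/val_inj; apply: mul1mx. Qed.
Fact SU2_mulVg : left_inverse SU2_one SU2_inv SU2_mul.
Proof.
move=> g; apply/val_inj; apply: mulVmx.
by rewrite unitmxE (SU2_eltsP (valP g)).2 unitr1.
Qed.
HB.instance Definition _ :=
  Finite_isGroup.Build SU2_group SU2_mulA SU2_mul1g SU2_mulVg.

Fact SU2_incl_repr : mx_repr [set: SU2_group] (fun g => val g : 'M[C]_2).
Proof. by []. Qed.

Definition SU2_incl : mx_representation C [set: SU2_group] 2 :=
  MxRepresentation SU2_incl_repr.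
End SU2.

(* Main.v *)
Require Import Defs.
From HB Require Import structures.
From mathcomp Require Import monalg.
From mathcomp Require Import all_boot all_order all_algebra all_fingroup.
From mathcomp Require Import all_solvable all_field all_character.
From mathcomp Require Import finmap complex boolp reals.
From mathcomp Require Import ring.

Set Implicit Arguments.
Unset Strict Implicit.
Unset Printing Implicit Defensive.

Import GRing.Theory Num.Theory.
Local Open Scope ring_scope.

(** Let V = K^2, let B be the crossed product of its exterior algebra with a
    finite group G acting on V through SL(2), and let V_a run over the
    irreducible representations of G.  Let e_a be the primitive idempotent of
    K[G] that acts on V_a as the matrix unit E_00 and on the other V_b as 0, and
    e the sum of the e_a.  The matrix units of K[G] show that B e B = B, so that
    B is Morita equivalent to the corner e B e ([corner_morita],
    [vertex_full]).  The point is that e B e is the zigzag algebra of the McKay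
    graph.

    B is graded by exterior degree.  In degrees 0 and 2 the space e_a B e_b is
    zero for a <> b, while for a = b it is a line, spanned by e_a and by
    w e_a, where w spans the second exterior power, on which G acts trivially
    because the determinants are 1 ([vertex_corner]).  In degree 1 it is the
    image of e_a on V (x) V_b, whose dimension is the multiplicity of V_a
    there ([arrow_ex]).  The McKay graph has no multiple edges, so each oriented
    edge a - b gives one arrow x_ab up to a scalar.  The product x_ab x_bc has
    degree 2: it vanishes when a <> c, and x_ab x_ba is a multiple of w e_a.

    It remains to make that multiple independent of b.  Let tau be the linear
    form reading the coefficient of w at the identity of G.  In degree 1 it is
    nondegenerate ([top_trace_nondeg]) and satisfies tau(xy) = - tau(yx)
    ([top_trace_anti]).  Hence tau(x_ab x_ba) is nonzero and can be rescaled to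
    1, but then tau(x_ba x_ab) is -1.  Here -1 in G enters: its sign on V_a
    changes along every edge ([mckay_parity]), so the graph is bipartite and
    the value 1 can be given to all the even vertices and -1 to all the odd
    ones.  The zigzag relations follow ([mckay_system]), and give a map from the
    zigzag algebra onto e B e ([zigzag_lift]).  It is injective because the
    zigzag algebra is no larger: in a connected graph with more than two
    vertices the paths of length 3 vanish, so it is spanned by the vertices, the
    arrows and one loop at each vertex ([zp_long], [zp_corner]).

    That the McKay graph is admissible is a computation with characters
    ([mckay_admissible]).  The multiplicity of V_b in V (x) V_a is symmetric in
    a and b, since the character of V takes the same value at g and at its
    inverse.  For a nonempty set S of vertices closed under adjacency, the sum f
    of the d_a chi_a over S satisfies chi_V f = 2 f, and chi_V = 2 only at the
    identity; so f is supported at the identity, which forces S to be everything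
    ([mckay_closed]).  There are at least three vertices because G is larger
    than {1, -1}.  In such a connected graph the degree identity
    2 d_a = sum_b m_ab d_b excludes multiple edges. *)

(** * Modules induced by a matrix representation of an algebra *)

Section MatrixFunctor.
Variable K : fieldType.

(** A multiplicative linear map from A to I x I matrices over B that need not
    send 1 to the identity matrix.  Both functors of the equivalence come from
    such a map: an embedding of a corner (I a point), and its inverse up to
    Morita equivalence. *)
Record nonunital_mxrep (A B : algType K) (I : finType) := NonunitalMxrep {
  mxrep :> A -> I -> I -> B;
  mxrepP : forall (c : K) x y i j,
    mxrep (c *: x + y) i j = c *: mxrep x i j + mxrep y i j;
  mxrepM : forall x y i j,
    mxrep (x * y) i j = \sum_k mxrep x i k * mxrep y k j
}.

Section Module.
Variables (A B : algType K) (I : finType) (rho : nonunital_mxrep A B I).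
Variable M : lmodType B.
Implicit Types (x y : A) (w : {ffun I -> M}).

Definition mxrep_app x w : {ffun I -> M} := [ffun i => \sum_j rho x i j *: w j].

Lemma mxrep_appDr x : {morph mxrep_app x : v w / v + w}.
Proof.
move=> v w; apply/ffunP=> i; rewrite !ffunE -big_split.
by apply: eq_bigr => j _; rewrite ffunE scalerDr.
Qed.

Lemma mxrep_appBr x : {morph mxrep_app x : v w / v - w}.
Proof.
move=> v w; apply/ffunP=> i; rewrite !ffunE -sumrB.
by apply: eq_bigr => j _; rewrite !ffunE scalerBr.
Qed.

Lemma mxrep_appDl w : {morph mxrep_app^~ w : x y / x + y}.
Proof.
move=> x y; apply/ffunP=> i; rewrite !ffunE -big_split.
by apply: eq_bigr => j _; rewrite -[x]scale1r mxrepP !scale1r scalerDl.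
Qed.

Lemma mxrep_appM x y w : mxrep_app (x * y) w = mxrep_app x (mxrep_app y w).
Proof.
apply/ffunP=> i; rewrite !ffunE.
under eq_bigr do rewrite mxrepM scaler_suml.
under [RHS]eq_bigr do rewrite ffunE scaler_sumr.
rewrite exchange_big; apply: eq_bigr => j _.
by apply: eq_bigr => k _; rewrite scalerA.
Qed.

Lemma mxrep_appZ (c : K) w :
  mxrep_app c%:A w = [ffun i => c%:A *: mxrep_app 1 w i].
Proof.
have rho0 i j : rho 0 i j = 0.
  by have := mxrepP rho (-1) 0 0 i j; rewrite scaler0 addr0 scaleN1r addNr.
apply/ffunP=> i; rewrite !ffunE scaler_sumr; apply: eq_bigr => j _.
rewrite -[c *: 1]addr0 mxrepP rho0 addr0 scalerA; congr (_ *: _).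
by rewrite mulr_algl.
Qed.

Definition mxrep_fixed : {pred {ffun I -> M}} := fun w => mxrep_app 1 w == w.

Fact mxrep_fixed_zmod : zmod_closed mxrep_fixed.
Proof.
split=> [|v w /eqP fv /eqP fw]; apply/eqP; last by rewrite mxrep_appBr fv fw.
by rewrite -{1}(subrr 0) mxrep_appBr subrr.
Qed.
HB.instance Definition _ :=
  GRing.isZmodClosed.Build _ mxrep_fixed mxrep_fixed_zmod.

(** The image of the idempotent matrix rho(1) on M^I, cut out as its fixed
    points so that it is a submodule with decidable membership. *)
Definition mxrep_mod : Type := {w : {ffun I -> M} | mxrep_fixed w}.
HB.instance Definition _ := SubChoice.on mxrep_mod.
HB.instance Definition _ := [SubChoice_isSubZmodule of mxrep_mod by <:].

Implicit Types u v : mxrep_mod.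

Lemma mxrep_modP u : mxrep_app 1 (val u) = val u.
Proof. exact/eqP/(valP u). Qed.

Fact mxrep_scale_subproof x u : mxrep_fixed (mxrep_app x (val u)).
Proof. by apply/eqP; rewrite -mxrep_appM mul1r. Qed.
Definition mxrep_scale x u : mxrep_mod := Sub _ (mxrep_scale_subproof x u).

Fact mxrep_scaleA x y u :
  mxrep_scale x (mxrep_scale y u) = mxrep_scale (x * y) u.
Proof. by apply: val_inj; rewrite /= mxrep_appM. Qed.
Fact mxrep_scale1 : left_id 1 mxrep_scale.
Proof. by move=> u; apply: val_inj; apply: mxrep_modP. Qed.
Fact mxrep_scaleDr : right_distributive mxrep_scale +%R.
Proof. by move=> x u v; apply: val_inj; rewrite /= mxrep_appDr. Qed.
Fact mxrep_scaleDl u : {morph mxrep_scale^~ u : x y / x + y}.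
Proof. by move=> x y; apply: val_inj; rewrite /= mxrep_appDl. Qed.
HB.instance Definition _ := GRing.Zmodule_isLmodule.Build A mxrep_mod
  mxrep_scaleA mxrep_scale1 mxrep_scaleDr mxrep_scaleDl.

Lemma mxrep_modDE u v i : val (u + v) i = val u i + val v i.
Proof. by rewrite /= ffunE. Qed.

Lemma mxrep_modZE x u i : val (x *: u) i = \sum_j rho x i j *: val u j.
Proof. by rewrite /= ffunE. Qed.

Lemma mxrep_modE u i : \sum_j rho 1 i j *: val u j = val u i.
Proof. by rewrite -{2}mxrep_modP ffunE. Qed.

Lemma mxrep_mod_ext u v : (forall i, val u i = val v i) -> u = v.
Proof. by move=> uv; apply: val_inj; apply/ffunP. Qed.

Lemma mxrep_modZK (c : K) u i : val (c%:A *: u) i = c%:A *: val u i.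
Proof. by rewrite /= mxrep_appZ ffunE mxrep_modP. Qed.
End Module.

Section Map.
Variables (A B : algType K) (I : finType) (rho : nonunital_mxrep A B I).

Section Def.
Variables (M N : lmodType B) (f : {linear M -> N}).
Fact mxrep_map_subproof (u : mxrep_mod rho M) :
  mxrep_fixed rho [ffun i => f (val u i)].
Proof.
apply/eqP/ffunP=> i; rewrite !ffunE -[in RHS]mxrep_modE linear_sum.
by apply: eq_bigr => j _; rewrite ffunE linearZ.
Qed.
Definition mxrep_map u : mxrep_mod rho N := Sub _ (mxrep_map_subproof u).
Lemma mxrep_mapE u i : val (mxrep_map u) i = f (val u i).
Proof. by rewrite /= ffunE. Qed.
Fact mxrep_map_linear : linear mxrep_map.
Proof.
move=> x u v; apply: mxrep_mod_ext => i.
rewrite mxrep_modDE mxrep_modZE !mxrep_mapE mxrep_modDE mxrep_modZE.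
rewrite linearD linear_sum; congr (_ + _); apply: eq_bigr => j _.
by rewrite mxrep_mapE linearZ.
Qed.
HB.instance Definition _ := GRing.isSemilinear.Build A _ _ _ mxrep_map
  (GRing.semilinear_linear mxrep_map_linear).
End Def.

Definition mxrep_functor : linear_functor B A.
Proof.
exists (fun M => mxrep_mod rho M : lmodType A)
  (fun M N f => mxrep_map f : {linear mxrep_mod rho M -> mxrep_mod rho N}).
- by move=> M u; apply: mxrep_mod_ext => i; rewrite mxrep_mapE.
- by move=> M N P g f u; apply: mxrep_mod_ext => i; rewrite !mxrep_mapE.
move=> M N c f g h hE u; apply: mxrep_mod_ext => i.
by rewrite mxrep_modDE mxrep_modZK !mxrep_mapE.
Defined.
End Map.
End MatrixFunctor.

(** * Morita equivalence with a full corner *)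

Section Corner.
Variables (K : fieldType) (A B : algType K) (phi : {linear A -> B}).
Hypothesis phiM : {morph phi : x y / x * y}.
Hypothesis phi_inj : injective phi.
Hypothesis phi_onto : forall b, exists a, phi a = phi 1 * b * phi 1.
Variables (I : finType) (x y : I -> B).
Hypothesis full : \sum_i x i * phi 1 * y i = 1.

Local Notation e := (phi 1).

Lemma corner_idem : e * e = e. Proof. by rewrite -phiM mulr1. Qed.

(** The composite of the compression b |-> e b e with the inverse of phi. *)
Definition corner_inv (b : B) : A := projT1 (cid (phi_onto b)).
Lemma corner_invE b : phi (corner_inv b) = e * b * e.
Proof. exact: projT2 (cid (phi_onto b)). Qed.

Lemma corner_inv_linear (c : K) b b' :
  corner_inv (c *: b + b') = c *: corner_inv b + corner_inv b'.
Proof.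
apply: phi_inj; rewrite linearP !corner_invE mulrDr mulrDl.
by rewrite -scalerAr -!scalerAl.
Qed.

(** Inserting 1 = sum_i x_i e y_i between the two factors turns the
    compression, which is not multiplicative, into a sum of products. *)
Lemma corner_invM b b' :
  \sum_i corner_inv (b * x i) * corner_inv (y i * b') = corner_inv (b * b').
Proof.
apply: phi_inj; rewrite linear_sum corner_invE -[b in RHS]mulr1 -full.
rewrite mulr_sumr mulr_suml mulr_sumr mulr_suml; apply: eq_bigr => i _.
by rewrite phiM !corner_invE !mulrA -[X in X * y i]mulrA corner_idem.
Qed.

Lemma corner_inv1 : corner_inv 1 = 1.
Proof. by apply: phi_inj; rewrite corner_invE mulr1 corner_idem. Qed.

Lemma sum_unit (V : nmodType) (F : unit -> V) : \sum_i F i = F tt.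
Proof. by rewrite (big_pred1 tt) // => -[]. Qed.

Definition corner_rep : nonunital_mxrep A B unit.
Proof.
exists (fun a _ _ => phi a) => [c a b _ _|a b _ _]; first exact: linearP.
by rewrite sum_unit phiM.
Defined.

(** The identification of B with the corner of the I x I matrices over e B e cut
    out by the idempotent matrix (e y_i x_j e). *)
Definition blowup_rep : nonunital_mxrep B A I.
Proof.
exists (fun b i j => corner_inv (y i * b * x j)) => [c b b' i j|b b' i j].
  by rewrite mulrDr mulrDl -scalerAr -scalerAl corner_inv_linear.
under eq_bigr do rewrite -[y _ * b' * _]mulrA.
by rewrite corner_invM !mulrA.
Defined.

Section Unit.
Variable M : lmodType B.
Local Notation FM := (mxrep_mod corner_rep M).

Fact corner_el_subproof (m : M) :
  mxrep_fixed corner_rep [ffun _ : unit => e *: m].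
Proof.
by apply/eqP/ffunP=> i; rewrite !ffunE sum_unit ffunE scalerA corner_idem.
Qed.
Definition corner_el m : FM := Sub _ (corner_el_subproof m).

Lemma corner_elE m i : val (corner_el m) i = e *: m.
Proof. by rewrite ffunE. Qed.
Lemma corner_elK (u : FM) i : e *: val u i = val u i.
Proof. by rewrite -[RHS]mxrep_modE sum_unit; case: i. Qed.
Lemma corner_modZE a (u : FM) i : val (a *: u) i = phi a *: val u i.
Proof. by rewrite mxrep_modZE sum_unit; case: i. Qed.
Lemma corner_mod_sumE (F : I -> FM) i : val (\sum_j F j) i = \sum_j val (F j) i.
Proof.
apply: (big_morph (fun u : FM => val u i)) => [u v|]; first exact: mxrep_modDE.
by rewrite /= ffunE.
Qed.

Lemma blowup_actE b (f : {ffun I -> FM}) i t :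
  val (mxrep_app blowup_rep b f i) t
  = \sum_j (e * (y i * b * x j)) *: val (f j) t.
Proof.
rewrite ffunE corner_mod_sumE; apply: eq_bigr => j _.
by rewrite corner_modZE corner_invE -scalerA corner_elK.
Qed.

Lemma fullZ b (m : M) : \sum_j (b * x j) *: (e *: (y j *: m)) = b *: m.
Proof.
under eq_bigr do rewrite !scalerA.
by rewrite -scaler_suml -[in RHS](mulr1 b) -full mulr_sumr;
   under [in RHS]eq_bigr do rewrite !mulrA.
Qed.

Fact corner_unit_subproof (m : M) :
  mxrep_fixed blowup_rep [ffun i => corner_el (y i *: m)].
Proof.
apply/eqP/ffunP=> i; apply: mxrep_mod_ext => t; rewrite blowup_actE.
under eq_bigr do rewrite ffunE corner_elE mulrA.
by rewrite fullZ ffunE corner_elE mulr1 scalerA.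
Qed.
(** The unit M -> G (F M), with inverse w |-> sum_j x_j w_j. *)
Definition corner_unit m : mxrep_mod blowup_rep FM :=
  Sub _ (corner_unit_subproof m).

Lemma corner_unitE m i t : val (val (corner_unit m) i) t = e *: (y i *: m).
Proof. by rewrite /= !ffunE. Qed.

Fact corner_unit_linear : linear corner_unit.
Proof.
move=> b m m'; apply: mxrep_mod_ext => i; apply: mxrep_mod_ext => t.
rewrite mxrep_modDE mxrep_modDE corner_unitE.
rewrite (blowup_actE b (val (corner_unit m)) i t).
under eq_bigr do rewrite corner_unitE mulrA.
by rewrite fullZ corner_unitE !scalerDr !scalerA mulrA.
Qed.
HB.instance Definition _ := GRing.isSemilinear.Build B M _ _ corner_unit
  (GRing.semilinear_linear corner_unit_linear).

Lemma corner_unit_bij : bijective corner_unit.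
Proof.
exists (fun u : mxrep_mod blowup_rep FM =>
          \sum_j x j *: val (val u j) tt) => [m|u].
  under eq_bigr do rewrite corner_unitE -[x _]mul1r.
  by rewrite fullZ scale1r.
apply: mxrep_mod_ext => i; apply: mxrep_mod_ext => -[].
rewrite corner_unitE -{2}(mxrep_modP u) blowup_actE !scaler_sumr.
by apply: eq_bigr => j _; rewrite !scalerA mulr1 !mulrA.
Qed.
End Unit.

Section Counit.
Variable N : lmodType A.
Local Notation GN := (mxrep_mod blowup_rep N).

Definition counit_fun (n : N) : {ffun I -> N} :=
  [ffun i => corner_inv (y i) *: n].

Lemma blowup_counitE b n i :
  mxrep_app blowup_rep b (counit_fun n) i = corner_inv (y i * b) *: n.
Proof.
rewrite ffunE; under eq_bigr do rewrite ffunE scalerA.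
rewrite -scaler_suml; congr (_ *: n).
by under eq_bigr => j _ do rewrite -[y j]mulr1; rewrite corner_invM mulr1.
Qed.

Fact counit_row_subproof (n : N) : mxrep_fixed blowup_rep (counit_fun n).
Proof.
apply/eqP/ffunP=> i; by rewrite blowup_counitE ffunE mulr1.
Qed.
Definition counit_row n : GN := Sub _ (counit_row_subproof n).

Fact corner_counit_subproof (n : N) :
  mxrep_fixed corner_rep [ffun _ : unit => counit_row n].
Proof.
apply/eqP/ffunP=> i; rewrite ffunE sum_unit !ffunE; apply: val_inj.
apply/ffunP=> j; rewrite [LHS]blowup_counitE ffunE.
congr (_ *: n); apply: phi_inj.
by rewrite !corner_invE mulrA -mulrA corner_idem.
Qed.
(** The isomorphism N -> F (G N), with inverse w |-> sum_j (e x_j e) w_j. *)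
Definition corner_counit n : mxrep_mod corner_rep GN :=
  Sub _ (corner_counit_subproof n).

Lemma corner_counitE n t i :
  val (val (corner_counit n) t) i = corner_inv (y i) *: n.
Proof. by rewrite /= !ffunE. Qed.

Fact corner_counit_linear : linear corner_counit.
Proof.
move=> a n n'; apply: mxrep_mod_ext => t; apply: mxrep_mod_ext => i.
rewrite mxrep_modDE mxrep_modDE mxrep_modZE sum_unit corner_counitE.
have -> : val (phi a *: val (corner_counit n) tt) i
    = corner_inv (y i * phi a) *: n.
  have -> : val (corner_counit n) tt = counit_row n by rewrite ffunE.
  exact: blowup_counitE.
rewrite corner_counitE scalerDr scalerA; congr (_ *: n + _).
apply: phi_inj; rewrite phiM !corner_invE.
by rewrite -!mulrA -!phiM mul1r mulr1.
Qed.
HB.instance Definition _ := GRing.isSemilinear.Build A N _ _ corner_counit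
  (GRing.semilinear_linear corner_counit_linear).

Lemma corner_counit_bij : bijective corner_counit.
Proof.
exists (fun u : mxrep_mod corner_rep GN =>
          \sum_j corner_inv (x j) *: val (val u tt) j) => [n|u].
  under eq_bigr do rewrite corner_counitE scalerA -[x _]mul1r -[y _]mulr1.
  by rewrite -scaler_suml corner_invM mulr1 corner_inv1 scale1r.
apply: mxrep_mod_ext => -[]; apply: mxrep_mod_ext => i.
rewrite corner_counitE -{2}(mxrep_modE u) sum_unit mxrep_modZE scaler_sumr.
apply: eq_bigr => j _; rewrite scalerA; congr (_ *: _); apply: phi_inj.
rewrite phiM !corner_invE -[corner_rep _ _ _]/e !mulrA.
by rewrite -[_ * e * e]mulrA corner_idem.
Qed.
End Counit.

(** A full corner e B e, that is one with B e B = B, has the same modules as B.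
    Fullness is a finite expression of 1, which realises the inverse functor
    N |-> B e (x) N as a space of fixed vectors in N^I. *)
Lemma corner_morita : morita_equivalent B A.
Proof.
exists (mxrep_functor corner_rep), (mxrep_functor blowup_rep).
exists (fun M : lmodType B => @corner_unit M : {linear M -> _}).
exists (fun N : lmodType A => @corner_counit N : {linear N -> _}).
split.
- exact: corner_unit_bij.
- exact: corner_counit_bij.
- move=> M M' f m; apply: mxrep_mod_ext => i; apply: mxrep_mod_ext => t.
  rewrite [LHS]corner_unitE.
  rewrite [RHS](congr1 (fun w : mxrep_mod corner_rep M' => val w t)
                       (mxrep_mapE _ _ _)).
  by rewrite [RHS]mxrep_mapE corner_unitE !linearZ.
- move=> N N' f n; apply: mxrep_mod_ext => t; apply: mxrep_mod_ext => i.
  rewrite [LHS]corner_counitE.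
  rewrite [RHS](congr1 (fun w : mxrep_mod blowup_rep N' => val w i)
                       (mxrep_mapE _ _ _)).
  by rewrite [RHS]mxrep_mapE corner_counitE linearZ.
Qed.
End Corner.

(** * The zigzag algebra by generators and relations *)

Lemma connected_ind (V : finType) (r : rel V) (P : pred V) a :
    (forall b, connect r a b) -> P a -> (forall c d, P c -> r c d -> P d) ->
  forall b, P b.
Proof.
move=> conn Pa Pr b; have /connectP[p rp ->] := conn b.
elim: p a {conn} Pa rp => //= d p IHp a Pa /andP[rad].
exact/IHp/(Pr a).
Qed.

Lemma mul_linearl (K : fieldType) (A : algType K) k (u v w : A) :
  (k *: u + v) * w = k *: (u * w) + v * w.
Proof. by rewrite mulrDl -scalerAl. Qed.

Lemma mul_linearr (K : fieldType) (A : algType K) k (u v w : A) :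
  w * (k *: u + v) = k *: (w * u) + w * v.
Proof. by rewrite mulrDr -scalerAr. Qed.

Lemma mul_linear_mul (K : fieldType) (A : algType K) k (x y u v : A) :
  x * (k *: u + v) * y = k *: (x * u * y) + x * v * y.
Proof. by rewrite mul_linearr mul_linearl. Qed.

Section ZigzagGraph.
Variable Gm : zigzag_graph.
Implicit Types a b c d : vertex Gm.

Lemma adjacent_sym a b : adjacent a b = adjacent b a.
Proof. by rewrite /adjacent (edges_sym (zigzag_graphP Gm)). Qed.

Lemma adjacent_irr a : adjacent a a = false.
Proof. by rewrite /adjacent (no_loops (zigzag_graphP Gm)). Qed.

(** Otherwise {a, b} would be a union of components of a connected graph with
    more than two vertices. *)
Lemma adjacent_escape a b :
  exists c d, [/\ c \in [set a; b], adjacent c d & d \notin [set a; b]].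
Proof.
apply: contrapT => closed_ab; have gP := zigzag_graphP Gm.
have /subset_leq_card : [set: vertex Gm] \subset [set a; b].
  apply/subsetP=> d _; move: d.
  apply: (connected_ind (graph_connected gP a)) => [|c d abc cd].
    by rewrite set21.
  by apply: contrapT => /negP abd; apply: closed_ab; exists c, d.
rewrite cardsT cards2 leqNgt => /negP; apply.
by apply: leq_ltn_trans (more_than_two_vertices gP); case: (a != b).
Qed.

Lemma adjacent_ex a : exists b, adjacent a b.
Proof.
have [c [d [ac cd _]]] := adjacent_escape a a.
by exists d; move: ac cd; rewrite !inE orbb => /eqP->.
Qed.

End ZigzagGraph.

Section ZigzagPresentation.
Variables (K : fieldType) (Gm : zigzag_graph) (A : algType K).
Local Notation V := (vertex Gm).
Variable zp : seq V -> A.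
Implicit Types (a b c d : V) (s t : seq V) (u v : A).

(** What the proof uses about the zigzag algebra.  Abstracting it as an
    arbitrary algebra A keeps its construction as a quotient of the path
    algebra out of the computations. *)
Record zigzag_presentation : Prop := ZigzagPresentation {
  zpM : forall s t, zp s * zp t = zp (path_cat s t);
  zp_nonpath : forall s, ~~ is_path s -> zp s = 0;
  zp_sum1 : \sum_a zp [:: a] = 1;
  zp_straight : forall a b c,
    adjacent a b -> adjacent b c -> a != c -> zp [:: a; b; c] = 0;
  zp_back : forall a b c,
    adjacent a b -> adjacent a c -> zp [:: a; b; a] = zp [:: a; c; a];
  zp_ind : forall P : A -> Prop, (forall s, is_path s -> P (zp s)) ->
    (forall k u v, P u -> P v -> P (k *: u + v)) -> forall u, P u
}.

Hypothesis zpP : zigzag_presentation.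

Lemma zp_nil : zp [::] = 0. Proof. by rewrite zp_nonpath. Qed.

Lemma zp_straight_any a b c : a != c -> zp [:: a; b; c] = 0.
Proof.
move=> nac.
have [/and3P[ab bc _]|/(zp_nonpath zpP)//] := boolP (is_path [:: a; b; c]).
exact: zp_straight.
Qed.

(** A path of length 3 that survives the straight relations goes back and forth
    along one edge a - b.  A third vertex next to a or b allows the back
    relation to move one of the detours away from that edge, and a straight
    piece appears. *)
Lemma zp_long a b c d s : zp [:: a, b, c, d & s] = 0.
Proof.
have long3 : zp [:: a; b; c; d] = 0; last first.
  have [-> | ns] := eqVneq s [::]; first exact: long3.
  have: zp [:: a; b; c; d] * zp (d :: s) = zp [:: a, b, c, d & s].
    by rewrite zpM //= eqxx.
  by rewrite long3 mul0r.
have [/= /and4P[ab bc cd _]|/(zp_nonpath zpP)//] :=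
  boolP (is_path [:: a; b; c; d]).
have left0 a' b' c' d' : zp [:: a'; b'; c'] = 0 -> zp [:: a'; b'; c'; d'] = 0.
  by move=> z; have := zpM zpP [:: a'; b'; c'] [:: c'; d'];
     rewrite /= eqxx z mul0r.
have right0 a' b' c' d' : zp [:: b'; c'; d'] = 0 -> zp [:: a'; b'; c'; d'] = 0.
  by move=> z; have := zpM zpP [:: a'; b'] [:: b'; c'; d'];
     rewrite /= eqxx z mulr0.
have [eac|nac] := eqVneq a c; last exact/left0/zp_straight_any.
have [ebd|nbd] := eqVneq b d; last exact/right0/zp_straight_any.
rewrite -{c}eac -{d}ebd in bc cd *.
have [c [d [abc cd' ndab]]] := adjacent_escape a b.
move: ndab; rewrite !inE negb_or => /andP[nda ndb].
case/set2P: abc => ec; rewrite {c}ec in cd'.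
  have := zpM zpP [:: a; b; a] [:: a; b].
  rewrite (zp_back zpP ab cd') zpM //= !eqxx /= => <-.
  exact/right0/zp_straight_any.
have := zpM zpP [:: a; b] [:: b; a; b].
rewrite (zp_back zpP bc cd') zpM //= !eqxx /= => <-.
by apply/left0/zp_straight_any; rewrite eq_sym.
Qed.

Definition normal_form (x l y : A) (diag : bool) u :=
  exists k1 k2 k3, u = (if diag then k1 *: x + k2 *: l else 0) + k3 *: y.

Lemma normal_form_linear x l y diag k u v : normal_form x l y diag u ->
  normal_form x l y diag v -> normal_form x l y diag (k *: u + v).
Proof.
move=> [k1 [k2 [k3 ->]]] [k1' [k2' [k3' ->]]].
exists (k * k1 + k1'), (k * k2 + k2'), (k * k3 + k3').
case: diag; rewrite !scalerDl !scalerDr ?scaler0 ?add0r !scalerA //.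
by rewrite addrACA; congr (_ + _); rewrite addrACA.
Qed.

(** A path from a to b is trivial, an arrow, a loop or zero, which bounds the
    size of the algebra from above. *)
Lemma zp_corner a b c u : adjacent a c ->
  normal_form (zp [:: a]) (zp [:: a; c; a]) (zp [:: a; b]) (a == b)
    (zp [:: a] * u * zp [:: b]).
Proof.
move=> ac; elim/(zp_ind zpP): u => [s ps|k u v IHu IHv]; last first.
  by rewrite mul_linear_mul; apply: normal_form_linear.
have zero x l y diag : normal_form x l y diag 0.
  by exists 0, 0, 0; rewrite !scale0r !addr0 if_same.
case: s ps => // a' s ps.
move: ps; rewrite zpM //=.
case: (eqVneq a a') => [<-|_] ps; last by rewrite zp_nil mul0r.
rewrite zpM //=; have [<-|_] := eqVneq (last a s) b; last by rewrite zp_nil.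
rewrite cats0; case: s ps => [|d [|f [|g s]]] ps.
- by exists 1, 0, 0 => /=; rewrite eqxx !scale0r scale1r !addr0.
- by exists 0, 0, 1; rewrite /= !scale0r scale1r addr0 if_same add0r.
- rewrite /=; have [<-|naf] := eqVneq a f; last first.
    by rewrite (zp_straight_any d naf).
  exists 0, 1, 0; rewrite !scale0r scale1r addr0 add0r.
  by case/and3P: ps => ad _ _; apply: zp_back.
by rewrite zp_long.
Qed.

Section ZigzagSystem.
Variable B : algType K.
Variables (e : V -> B) (y : V -> V -> B) (l : V -> B).

Record zigzag_system : Prop := ZigzagSystem {
  sys_orth : forall a b, e a * e b = if a == b then e a else 0;
  sys_arrow : forall a b, e a * y a b * e b = y a b;
  sys_straight : forall a b c,
    adjacent a b -> adjacent b c -> a != c -> y a b * y b c = 0;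
  sys_back : forall a b, adjacent a b -> y a b * y b a = l a
}.

(** The e a, the l a and the y a b with a adjacent to b form a basis of the
    corner cut out by the sum of the e a. *)
Record zigzag_basis : Prop := ZigzagBasis {
  basis_diag : forall a (v : B),
    exists k1 k2, e a * v * e a = k1 *: e a + k2 *: l a;
  basis_free : forall a k1 k2, k1 *: e a + k2 *: l a = 0 -> k1 = 0 /\ k2 = 0;
  basis_arrow : forall a b (v : B), adjacent a b ->
    exists k, e a * v * e b = k *: y a b;
  basis_arrow_neq0 : forall a b, adjacent a b -> y a b != 0;
  basis_far : forall a b (v : B), a != b -> ~~ adjacent a b -> e a * v * e b = 0
}.

Hypothesis sysP : zigzag_system.
Hypothesis basisP : zigzag_basis.
Variable phi : {linear A -> B}.
Hypothesis phiM : {morph phi : u v / u * v}.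
Hypothesis phi_vertex : forall a, phi (zp [:: a]) = e a.
Hypothesis phi_arrow : forall a b, adjacent a b -> phi (zp [:: a; b]) = y a b.

Lemma phi_loop a c : adjacent a c -> phi (zp [:: a; c; a]) = l a.
Proof.
move=> ac; have := zpM zpP [:: a; c] [:: c; a]; rewrite /= eqxx => <-.
have ca : adjacent c a by rewrite adjacent_sym.
by rewrite phiM !phi_arrow // (sys_back sysP).
Qed.

Lemma phi_one : phi 1 = \sum_a e a.
Proof. by rewrite -(zp_sum1 zpP) linear_sum; apply: eq_bigr => a _. Qed.

(** Compressed between two vertices, an element of A is a combination of at most
    two basic elements, whose images are linearly independent. *)
Lemma zigzag_phi_inj : injective phi.
Proof.
suffices ker u : phi u = 0 -> u = 0.
  move=> u v /eqP; rewrite -subr_eq0 -linearB => /eqP/ker/eqP.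
  by rewrite subr_eq0 => /eqP.
move=> u0; rewrite -[u]mul1r -[_ * u]mulr1 -(zp_sum1 zpP) !mulr_suml.
apply: big1 => a _; rewrite mulr_sumr; apply: big1 => b _.
have [c ac] := adjacent_ex a.
have : phi (zp [:: a] * u * zp [:: b]) = 0 by rewrite !phiM u0 mulr0 mul0r.
have [k1 [k2 [k3 ->]]] := zp_corner b u ac; rewrite linearD.
have [<-|nab] := eqVneq a b.
  have aa : zp [:: a; a] = 0.
    by apply: (zp_nonpath zpP); rewrite /= adjacent_irr.
  rewrite aa scaler0 linear0 addr0.
  rewrite linearD !linearZ /= phi_vertex phi_loop //.
  by move=> /(basis_free basisP)[-> ->]; rewrite !scale0r !addr0.
rewrite linear0 add0r linearZ /=; have [ab|nadj] := boolP (adjacent a b).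
  rewrite phi_arrow // add0r => /eqP; rewrite scaler_eq0.
  rewrite (negPf (basis_arrow_neq0 basisP ab)) orbF => /eqP->.
  by rewrite scale0r.
by rewrite (zp_nonpath zpP) ?scaler0 ?addr0 //= (negPf nadj).
Qed.

Lemma zigzag_phi_onto (v : B) : exists u, phi u = phi 1 * v * phi 1.
Proof.
have img a b : exists u, phi u == e a * v * e b.
  have [<-|nab] := eqVneq a b.
    have [c ac] := adjacent_ex a; have [k1 [k2 ->]] := basis_diag basisP a v.
    exists (k1 *: zp [:: a] + k2 *: zp [:: a; c; a]); apply/eqP.
    by rewrite linearD !linearZ /= phi_vertex phi_loop.
  have [ab|nadj] := boolP (adjacent a b).
    have [k ->] := basis_arrow basisP v ab.
    by exists (k *: zp [:: a; b]); rewrite linearZ /= phi_arrow.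
  by exists 0; rewrite linear0 (basis_far basisP).
exists (\sum_a \sum_b xchoose (img a b)); rewrite phi_one !mulr_suml linear_sum.
apply: eq_bigr => a _; rewrite mulr_sumr linear_sum; apply: eq_bigr => b _.
exact/eqP/(xchooseP (img a b)).
Qed.

Lemma zigzag_morita (I : finType) (p q : I -> B) :
  \sum_i p i * (\sum_a e a) * q i = 1 -> morita_equivalent B A.
Proof.
rewrite -phi_one => full.
exact: corner_morita phiM zigzag_phi_inj zigzag_phi_onto _ _ _ full.
Qed.
End ZigzagSystem.
End ZigzagPresentation.

Section ZigzagAlgebra.
Variables (K : fieldType) (Gm : zigzag_graph).
Local Notation V := (vertex Gm).
Local Notation Z := (zigzag_algebra K Gm).
Implicit Types (a b c d : V) (s t : seq V).

Definition zpth s : Z := quot_proj (zigzag_ideal K Gm) (pth K s).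

Lemma quot_proj0 (A : algType K) (J : proper_two_sided_ideal A) :
  quot_proj J 0 = 0.
Proof. by have := quot_projZE J 0 0; rewrite !scale0r. Qed.

Lemma zpth_presentation : zigzag_presentation zpth.
Proof.
split.
- by move=> s t; rewrite /zpth -path_mul_pth quot_projM.
- by move=> s ns; rewrite /zpth (pth0 K ns) quot_proj0.
- rewrite -[RHS]/(quot_proj (zigzag_ideal K Gm) (path_one K Gm)) /path_one.
  apply/esym/(big_morph (quot_proj (zigzag_ideal K Gm))).
    exact: quot_projD.
  exact: quot_proj0.
- move=> a b c ab bc nac; rewrite -(quot_proj0 (zigzag_ideal K Gm)).
  by apply/quot_projP; rewrite subr0 => J _; apply; apply: zigzag_rel_straight.
- by move=> a b c ab ac; apply/quot_projP => J _; apply; apply: zigzag_rel_back.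
move=> P Pp PD u; rewrite -[u]quot_reprK; move: (quot_repr _) => x {u}.
elim/path_algebra_ind: x => [[s ps]||k x y Px Py].
- by rewrite -pth_val; apply: Pp.
- have [a _] := graph_vertex Gm; have Pa := Pp [:: a] isT.
  by have := PD (-1) _ _ Pa Pa; rewrite scaleN1r addNr quot_proj0.
by rewrite quot_projD quot_projZE; apply: PD.
Qed.

Section Lift.
Variable B : algType K.
Variables (e : V -> B) (y : V -> V -> B) (l : V -> B).
Hypothesis sysP : zigzag_system e y l.

Lemma sys_target a b : y a b * e b = y a b.
Proof. by rewrite -(sys_arrow sysP a b) -mulrA (sys_orth sysP) eqxx. Qed.

Fixpoint path_val a s : B := if s is b :: t then y a b * path_val b t else e a.
(** A path is never the empty sequence, so the value 0 is not reached. *)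
Definition gpath_val (p : gpath Gm) : B :=
  if val p is a :: s then path_val a s else 0.

Lemma path_val_src a b s :
  e a * path_val b s = if a == b then path_val b s else 0.
Proof.
case: s => [|c s] /=; first by rewrite (sys_orth sysP); case: eqP => // ->.
rewrite -(sys_arrow sysP b c) !mulrA (sys_orth sysP).
by case: eqP => [->//|_]; rewrite !mul0r.
Qed.

Lemma path_val_cat a s b t : path_val a s * path_val b t
  = if last a s == b then path_val a (s ++ t) else 0.
Proof.
elim: s a => [|c s IHs] a /=; first by rewrite path_val_src; case: eqP => // ->.
by rewrite -mulrA IHs; case: eqP => // _; rewrite mulr0.
Qed.

Lemma lin_ext_pth a s : is_path (a :: s) ->
  lin_ext gpath_val (pth K (a :: s)) = path_val a s.
Proof.
move=> ps; rewrite -[a :: s]/(val (Sub (a :: s) ps : gpath Gm)) pth_val.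
by rewrite lin_ext1.
Qed.

Lemma lin_ext_pathM (x z : path_algebra K Gm) :
  lin_ext gpath_val (x * z) = lin_ext gpath_val x * lin_ext gpath_val z.
Proof.
have := lin_ext_linear gpath_val; have := lin_ext_pth.
(* Only linearity and the values on paths matter from here on. *)
move: (lin_ext gpath_val) => f fpth fP.
have f0 : f 0 = 0 by have := fP (-1) 0 0; rewrite scaler0 addr0 scaleN1r addNr.
elim/path_algebra_ind: x => [[[|a s] ps]||k x x' IHx IHx'] //; last 2 first.
- by rewrite [0 * z]path_mul0l f0 mul0r.
- have -> : (k *: x + x') * z = k *: (x * z) + x' * z by exact: path_mulPl.
  by rewrite (fP k (x * z) (x' * z)) (fP k x x') mul_linearl -IHx -IHx'.
elim/path_algebra_ind: z => [[[|b t] pt]||k z z' IHz IHz'] //; last 2 first.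
- by rewrite [_ * 0]path_mul0r f0 mulr0.
- set x : path_algebra K Gm := << _ >>.
  have -> : x * (k *: z + z') = k *: (x * z) + x * z'.
    exact: path_mulPr.
  by rewrite (fP k (x * z) (x * z')) (fP k z z') mul_linearr -IHz -IHz'.
rewrite -!pth_val /= !fpth // path_val_cat.
rewrite [pth K _ * pth K _]path_mul_pth /=; case: eqP => [ab|_].
  rewrite fpth //= cat_path ab; exact/andP.
by rewrite pth0.
Qed.

(** The universal property of the zigzag algebra for algebra maps that need not
    preserve 1. *)
Lemma zigzag_lift : exists phi : {linear Z -> B},
  [/\ {morph phi : u v / u * v}, forall a, phi (zpth [:: a]) = e a
    & forall a b, adjacent a b -> phi (zpth [:: a; b]) = y a b].
Proof.
have ker x : ideal_gen (@zigzag_rel K Gm) x -> lin_ext gpath_val x = 0.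
  move=> /(_ (fun x => lin_ext gpath_val x = 0)); apply; first split.
  - exact: linear0.
  - by move=> u v u0 v0; rewrite linearD /= u0 v0 addr0.
  - by move=> u v v0; rewrite lin_ext_pathM v0 mulr0.
  - by move=> u v v0; rewrite lin_ext_pathM v0 mul0r.
  move=> _ [a b c ab bc nac|a b c ab ac].
    rewrite lin_ext_pth /= ?ab ?bc //.
    by rewrite sys_target (sys_straight sysP ab bc nac).
  rewrite linearB /= !lin_ext_pth /= ?ab ?ac 1?adjacent_sym ?ab ?ac //.
  by rewrite !sys_target !(sys_back sysP) // subrr.
pose phi (u : Z) := lin_ext gpath_val (quot_repr u).
have phiE x : phi (quot_proj _ x) = lin_ext gpath_val x.
  apply/eqP; rewrite -subr_eq0 -linearB; apply/eqP/ker.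
  exact: (quot_projK (zigzag_ideal K Gm)).
have phiL : linear phi.
  move=> k u v; rewrite -[u]quot_reprK -[v]quot_reprK -quot_projZE -quot_projD.
  by rewrite !phiE linearP.
pose phiLm := GRing.isSemilinear.Build K Z B _ phi
  (GRing.semilinear_linear phiL).
pose phi' : {linear Z -> B} := HB.pack phi phiLm.
exists phi'; split=> [u v|a|a b ab].
- rewrite -[u]quot_reprK -[v]quot_reprK -quot_projME.
  by rewrite [LHS]phiE lin_ext_pathM /phi' /= !phiE.
- by rewrite [LHS]phiE lin_ext_pth.
by rewrite [LHS]phiE lin_ext_pth /= ?ab //; apply: sys_target.
Qed.
End Lift.
End ZigzagAlgebra.

(** * Characters over an algebraically closed field of characteristic zero *)

Section GroupCharacters.
Variables (K : numClosedFieldType) (gT : finGroupType).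
Local Notation G := [set: gT].
Variable sG : irrType K [set: gT].
Implicit Types (a b c : sG) (g h : gT) (u v : gT -> K).

Let inG g : g \in [set: gT]. Proof. exact: in_setT. Qed.

Lemma pchar_group : ([pchar K]^'.-group [set: gT])%g.
Proof.
apply: sub_in_pnat (pnat_pi (cardG_gt0 _)) => p _ _.
by rewrite inE /= pchar_num.
Qed.

(** The action of the element sum_g u(g) g of the group algebra. *)
Definition group_eval n (r : mx_representation K [set: gT] n) u : 'M[K]_n :=
  \sum_g u g *: r g.

(** The irreducible representations are absolutely irreducible over a closed
    field, hence onto matrices; multiplication by a Wedderburn idempotent
    isolates one of them. *)
Lemma irr_eval_onto a (M : 'M[K]_(irr_degree a)) : exists u,
  group_eval (irr_repr a) u = M /\
  forall b, b != a -> group_eval (irr_repr b) u = 0.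
Proof.
have splitG := @group_closure_closed_field K gT [set: gT]%G.
have /andP[_ fullE] := splitG _ _ (socle_irr a).
have /envelop_mxP[c Mc] : (M \in enveloping_algebra_mx (irr_repr a))%MS.
  exact: submx_full.
(* A acts on V_a as M; its product with the idempotent of a kills the others. *)
pose A := (\sum_(x in [set: gT]) c x *: regular_repr K [set: gT] x)%R.
have RA : (A \in group_ring K [set: gT])%MS by apply/envelop_mxP; exists c.
have Rea : (Wedderburn_id a \in group_ring K [set: gT])%MS.
  rewrite -(Wedderburn_sum_pchar sG pchar_group).
  exact: submx_trans (Wedderburn_id_mem a) (sumsmx_sup a _ _).
have /envelop_mxP[u uA] : (A *m Wedderburn_id a \in group_ring K [set: gT])%MS.
  exact: envelop_mxM.
have evalE b : group_eval (irr_repr b) u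
    = gring_op (irr_repr b) (A *m Wedderburn_id a).
  rewrite uA linear_sum; apply: eq_big => [g|g _]; first by rewrite inG.
  by rewrite linearZ /= gring_opG.
exists u; split=> [|b nba]; rewrite evalE gring_opM //; last first.
  rewrite (irr_repr'_op0_pchar pchar_group _ (Wedderburn_id_mem a)) ?mulmx0 //.
  by rewrite eq_sym.
rewrite (op_Wedderburn_id_pchar pchar_group) mulmx1 Mc linear_sum.
by apply: eq_bigr => g _; rewrite linearZ /= gring_opG.
Qed.

Definition irr_chi a g : K := \tr (irr_repr a g).
Local Notation d a := ((irr_degree a)%:R : K).

Lemma irr_chi_regular g :
  \sum_a d a * irr_chi a g = if g == 1%g then #|gT|%:R else 0.
Proof.
have splitG := @group_closure_closed_field K gT [set: gT]%G.
have := mxtrace_regular_pchar sG pchar_group splitG (inG g).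
under [X in _ = X -> _]eq_bigr do rewrite -mulr_natl.
move=> <-; case: eqP => [->|/eqP ng].
  by rewrite repr_mx1 mxtrace1 -cardsT.
rewrite [LHS]big1 // => i _; rewrite 2!mxE /=.
rewrite -(inj_eq enum_val_inj) gring_indexK ?groupM ?enum_valP //.
by rewrite eq_mulVg1 mulKg (negbTE ng).
Qed.

(** Complete reducibility, read on traces: the isotypic components of rW are
    indexed by distinct irreducible representations. *)
Lemma irr_mult_trace n (rW : mx_representation K [set: gT] n) g :
  \tr (rW g) = \sum_b (@irr_mult K gT [set: gT]%G sG n rW b)%:R * irr_chi b g.
Proof.
have Soc1 :=
  reducible_Socle1 (DecSocleType rW) (mx_Maschke_pchar rW pchar_group).
have Soc1e : (Socle (DecSocleType rW) :=: 1%:M)%MS by rewrite Soc1.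
rewrite -(mxtrace_submod1 (Socle_module _) Soc1e (inG g)) mxtrace_Socle //.
(* Distinct components have non-isomorphic constituents. *)
pose f (W : DecSocleType rW) := irr_comp sG (socle_repr W).
have f_inj : injective f.
  move=> W W' eqf; apply/eqP/socle_rsimP.
  apply: mx_rsim_trans
    (rsim_irr_comp_pchar sG pchar_group (socle_irr _)) (mx_rsim_sym _).
  rewrite -/(f W) eqf; apply: rsim_irr_comp_pchar (socle_irr _).
  exact: pchar_group.
rewrite (partition_big f predT) //=; apply: eq_bigr => b _.
rewrite /irr_mult; case: pickP => [W /eqP fW|noW]; last first.
  by rewrite mul0r big1 // => W /eqP fW; move: (noW W); rewrite -/(f W) fW eqxx.
rewrite (big_pred1 W) => [|W']; last by rewrite /= -fW (inj_eq f_inj).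
rewrite mulr_natl; congr (_ *+ _).
have := rsim_irr_comp_pchar sG pchar_group (socle_irr W).
by rewrite fW => /mxtrace_rsim -> //.
Qed.

Lemma trace_group_eval n (r : mx_representation K [set: gT] n) u h :
  \tr (group_eval r u *m r h) = \sum_g u g * \tr (r (g * h)%g).
Proof.
rewrite mulmx_suml linear_sum; apply: eq_bigr => g _.
by rewrite -scalemxAl linearZ /= repr_mxM.
Qed.

(** Fourier inversion: the regular character picks the coefficient at the
    identity. *)
Lemma group_eval_coeff u h :
  \sum_(a : sG) d a * \tr (group_eval (irr_repr a) u *m irr_repr a h^-1%g)
    = #|gT|%:R * u h.
Proof.
under eq_bigr do rewrite trace_group_eval mulr_sumr.
rewrite exchange_big (bigD1 h) //= [X in _ + X]big1 ?addr0 => [|g ngh].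
  under eq_bigr do rewrite mulrCA.
  by rewrite -mulr_sumr irr_chi_regular mulgV eqxx mulrC.
under eq_bigr do rewrite mulrCA.
by rewrite -mulr_sumr irr_chi_regular -eq_mulgV1 (negPf ngh) mulr0.
Qed.

Let card_neq0 : #|gT|%:R != 0 :> K.
Proof. by rewrite pnatr_eq0 -cardsT -lt0n cardG_gt0. Qed.

Let degree_neq0 a : d a != 0.
Proof. by rewrite pnatr_eq0 -lt0n irr_degree_gt0. Qed.

Lemma irr_eval_inj u v :
    (forall a : sG, group_eval (irr_repr a) u = group_eval (irr_repr a) v) ->
  u =1 v.
Proof.
move=> uv h; apply: (mulfI card_neq0); rewrite -!group_eval_coeff.
by apply: eq_bigr => a _; rewrite uv.
Qed.

Lemma irr_chi1 a : irr_chi a 1%g = d a.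
Proof. by rewrite /irr_chi repr_mx1 mxtrace1. Qed.

(** Compare, by Fourier inversion, chi_a with the central idempotent of V_a. *)
Lemma irr_chi_orth a b :
  \sum_g irr_chi a g^-1%g * irr_chi b g = if a == b then #|gT|%:R else 0.
Proof.
have [u [ua1 u0]] := irr_eval_onto (1%:M : 'M_(irr_degree a)).
have uE g : #|gT|%:R * u g = d a * irr_chi a g^-1%g.
  rewrite -group_eval_coeff (bigD1 a) //= big1 => [|c /u0->].
    by rewrite ua1 mul1mx addr0.
  by rewrite mul0mx mxtrace0 mulr0.
apply: (mulfI (degree_neq0 a)); rewrite mulr_sumr.
under eq_bigr do rewrite mulrA -uE -mulrA.
have := trace_group_eval (irr_repr b) u 1%g.
rewrite repr_mx1 mulmx1 -mulr_sumr => trE.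
have -> : \sum_g u g * irr_chi b g = \tr (group_eval (irr_repr b) u).
  by rewrite trE; apply: eq_bigr => g _; rewrite mulg1.
case: eqP => [<-|/eqP nab]; first by rewrite ua1 mxtrace1 mulrC.
by rewrite u0 1?eq_sym // mxtrace0 !mulr0.
Qed.

Lemma irr_mult_inner n (rW : mx_representation K [set: gT] n) b :
  \sum_g irr_chi b g^-1%g * \tr (rW g)
    = #|gT|%:R * (@irr_mult K gT [set: gT]%G sG n rW b)%:R.
Proof.
under eq_bigr do rewrite irr_mult_trace mulr_sumr.
rewrite exchange_big (bigD1 b) //= [X in _ + X]big1 ?addr0 => [|c ncb].
  under eq_bigr do rewrite mulrCA.
  by rewrite -mulr_sumr irr_chi_orth eqxx mulrC.
under eq_bigr do rewrite mulrCA.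
by rewrite -mulr_sumr irr_chi_orth eq_sym (negPf ncb) mulr0.
Qed.
End GroupCharacters.

Section SL2.
Variable K : fieldType.
Implicit Types g : 'M[K]_2.

Lemma mxtrace_adj2 g : \tr (\adj g) = \tr g.
Proof.
rewrite /mxtrace !sum2 !mxE /cofactor !det_mx11 !mxE.
have -> : lift (0 : 'I_2) (0 : 'I_1) = 1 by apply/val_inj.
have -> : lift (1 : 'I_2) (0 : 'I_1) = 0 by apply/val_inj.
by rewrite expr0 -signr_odd expr0 !mul1r addrC.
Qed.

End SL2.

(** * The McKay graph of a finite subgroup of SL(2) *)

(** The Cayley-Hamilton theorem. *)
Lemma SL2_square (K : fieldType) (g : 'M[K]_2) :
  \det g = 1 -> g *m g = \tr g *: g - 1%:M.
Proof.
move=> g1; have adjE : \adj g = (\tr g)%:M - g.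
  apply/matrixP=> i j; rewrite !mxE /mxtrace sum2 /cofactor det_mx11 !mxE.
  have l01 : lift (0 : 'I_2) (0 : 'I_1) = 1 by apply/val_inj.
  have l10 : lift (1 : 'I_2) (0 : 'I_1) = 0 by apply/val_inj.
  have [->|->] : i = 0 \/ i = 1.
  - by case: i => [[|[|//]] ?]; [left | right]; apply/val_inj.
  - have [->|->] : j = 0 \/ j = 1.
    + by case: j => [[|[|//]] ?]; [left | right]; apply/val_inj.
    + by rewrite l01 /= expr0 mulr1n; ring.
    + by rewrite l10 l01 /= expr1 mulr0n; ring.
  have [->|->] : j = 0 \/ j = 1.
  - by case: j => [[|[|//]] ?]; [left | right]; apply/val_inj.
  - by rewrite l01 l10 /= expr1 mulr0n; ring.
  - by rewrite l10 /= -signr_odd /= expr0 mulr1n; ring.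
have := mul_mx_adj g; rewrite adjE g1 mulmxBr mul_mx_scalar => <-.
by rewrite opprB addrC subrK.
Qed.

Section McKayGraph.
Variables (K : numClosedFieldType) (gT : finGroupType).
Variable sG : irrType K [set: gT].
Variable rV : mx_representation K [set: gT] 2.
Hypothesis rV_det : forall g, \det (rV g) = 1.
Hypothesis rV_inj : forall g, rV g = 1%:M -> g = 1%g.
Variable z : gT.
Hypothesis rV_z : rV z = - 1%:M.
Hypothesis more_than_pm1 : exists g : gT, g \notin [:: 1%g; z].

Implicit Types (a b c : sG) (g h : gT) (u v : gT -> K).
Local Notation m a b := (@mckay_edges K gT [set: gT]%G sG 2 rV a b).
Local Notation d a := (irr_degree a).
Let inG g : g \in [set: gT]. Proof. exact: in_setT. Qed.
Let chiV g := \tr (rV g).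
Local Notation N := (#|gT|%:R : K).

Lemma mckay_trace a g :
  chiV g * irr_chi a g = \sum_b (m a b)%:R * irr_chi b g.
Proof. by rewrite -irr_mult_trace mxtrace_prod. Qed.

Lemma mckay_inner a b :
  \sum_g irr_chi b g^-1%g * (chiV g * irr_chi a g) = N * (m a b)%:R.
Proof.
rewrite -irr_mult_inner; apply: eq_bigr => g _; congr (_ * _).
by rewrite mxtrace_prod.
Qed.

Let N_neq0 : N != 0.
Proof. by rewrite pnatr_eq0 -cardsT -lt0n cardG_gt0. Qed.

Lemma traceV_inv g : chiV g^-1%g = chiV g.
Proof.
rewrite /chiV -[RHS]mxtrace_adj2; congr (\tr _).
have := mul_mx_adj (rV g); rewrite rV_det => /(congr1 (mulmx (rV g^-1%g))).
by rewrite mulmxA -repr_mxM // mulVg repr_mx1 mul1mx mulmx1.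
Qed.

Lemma mckay_sym a b : m a b = m b a.
Proof.
apply/eqP; rewrite -(eqr_nat K) -(inj_eq (mulfI N_neq0)) -!mckay_inner.
rewrite (reindex_inj invg_inj) /=; apply/eqP/eq_bigr => g _.
by rewrite traceV_inv invgK; ring.
Qed.

Lemma mckay_degree a : (\sum_b m a b * d b = 2 * d a)%N.
Proof.
apply/eqP; rewrite -(eqr_nat K) natr_sum natrM; apply/eqP.
have := mckay_trace a 1%g; rewrite /chiV repr_mx1 mxtrace1 irr_chi1 => ->.
by apply: eq_bigr => b _; rewrite natrM irr_chi1.
Qed.

(** By Cayley-Hamilton g = 1 + n with n^2 = 0, so g^k = 1 + k n; as g has
    finite order and the characteristic is 0, n = 0. *)
Lemma trace2_eq1 g : chiV g = 2%:R -> g = 1%g.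
Proof.
rewrite /chiV => chi2; have := SL2_square (rV_det g); rewrite chi2 => gg.
pose n := rV g - 1%:M.
have nn : n *m n = 0.
  rewrite /n mulmxBl !mulmxBr gg !mulmx1 !mul1mx scaler_nat mulr2n.
  by rewrite opprB addrA [_ + rV g - _]addrAC addrK subrK subrr.
have powE k : rV (g ^+ k)%g = 1%:M + k%:R *: n.
  elim: k => [|k IHk]; first by rewrite repr_mx1 scale0r addr0.
  rewrite expgS repr_mxM // IHk -[rV g](subrK 1%:M) -/n.
  rewrite mulmxDl !mulmxDr -scalemxAr nn scaler0 !mul1mx !mulmx1 addr0.
  by rewrite addrCA -{1}[n]scale1r -scalerDl -natr1 [1 + _]addrC.
apply: rV_inj; have := powE #[g]%g; rewrite expg_order repr_mx1.
rewrite -{1}[1%:M]addr0 => /addrI/esym/eqP; rewrite scaler_eq0 pnatr_eq0.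
by rewrite -[_ == 0%N]negbK -lt0n order_gt0 subr_eq0 => /eqP.
Qed.

(** The McKay graph is connected: f = sum_(b in S) d_b chi_b satisfies
    chi_V f = 2 f when S is closed under adjacency, so f vanishes off the
    identity, where it is positive.  Such a class function has nonzero inner
    product with every chi_c. *)
Lemma mckay_closed (S : pred sG) a : S a ->
  (forall b c, S b -> (0 < m b c)%N -> S c) -> forall c, S c.
Proof.
move=> Sa closedS c; pose f g := \sum_(b | S b) (d b)%:R * irr_chi b g.
have m0 b b' : S b -> ~~ S b' -> m b b' = 0%N.
  move=> Sb /negP Sb'; apply/eqP; rewrite -leqn0 leqNgt.
  by apply/negP=> /(closedS _ _ Sb).
have Vf g : chiV g * f g = 2%:R * f g.
  rewrite /f !mulr_sumr; under eq_bigr do rewrite mulrCA mckay_trace mulr_sumr.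
  rewrite exchange_big /= [RHS]big_mkcond /=; apply: eq_bigr => b _.
  under eq_bigr do rewrite mulrA.
  rewrite -mulr_suml; case: ifPn => Sb; last first.
    by rewrite big1 ?mul0r // => b' Sb'; rewrite m0 ?mulr0.
  rewrite mulrA -natrM -mckay_degree natr_sum; congr (_ * _).
  rewrite [RHS](bigID S) /= [X in _ = _ + X]big1 ?addr0; last first.
    by move=> b' Sb'; rewrite m0.
  by apply: eq_bigr => b' _; rewrite natrM mulrC mckay_sym.
have f0 g : g != 1%g -> f g = 0.
  move=> ng; apply/eqP; have := Vf g; move/eqP.
  rewrite -subr_eq0 -mulrBl mulf_eq0.
  by case/orP=> //; rewrite subr_eq0 => /eqP/trace2_eq1/eqP; rewrite (negPf ng).
have f1 : f 1%g != 0.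
  have -> : f 1%g = (\sum_(b | S b) d b ^ 2)%:R.
    by rewrite natr_sum; apply: eq_bigr => b _; rewrite irr_chi1 -natrM.
  rewrite pnatr_eq0 (bigD1 a) //= addn_eq0 negb_and -lt0n sqrn_gt0.
  by rewrite irr_degree_gt0.
have : \sum_g irr_chi c g^-1%g * f g = (d c)%:R * f 1%g.
  rewrite (bigD1 1%g) //= big1 => [|g /f0->]; last by rewrite mulr0.
  by rewrite invg1 irr_chi1 addr0.
rewrite /f; under eq_bigr do rewrite mulr_sumr.
rewrite exchange_big /= => E; apply: contraT => Sc.
have: (d c)%:R * f 1%g != 0.
  by rewrite mulf_neq0 // pnatr_eq0 -lt0n irr_degree_gt0.
rewrite -E big1 ?eqxx // => b Sb; under eq_bigr do rewrite mulrCA.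
rewrite -mulr_sumr irr_chi_orth; case: eqP => [cb|_]; last by rewrite mulr0.
by rewrite cb Sb in Sc.
Qed.

(** The parity of V_a is odd when the central element -1 acts on it by -1. *)
Definition parity a : bool := irr_repr a z != 1%:M.

Lemma minus1_central g : (z * g = g * z)%g.
Proof.
have eqV h k : rV h = rV k -> h = k.
  move=> hk; apply/eqP; rewrite eq_mulgV1; apply/eqP/rV_inj.
  by rewrite repr_mxM // hk -repr_mxM // mulgV repr_mx1.
by apply: eqV; rewrite !repr_mxM // rV_z mulNmx mulmxN mul1mx mulmx1.
Qed.

Lemma minus1_square : (z * z = 1)%g.
Proof.
by apply: rV_inj; rewrite repr_mxM // rV_z mulNmx mulmxN opprK mulmx1.
Qed.

Lemma irr_repr_z a : irr_repr a z = ((-1) ^+ parity a)%:M.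
Proof.
have splitG := @group_closure_closed_field K gT [set: gT]%G.
have /is_scalar_mxP[s sE] : is_scalar_mx (irr_repr a z).
  apply: (mx_abs_irr_cent_scalar (splitG _ _ (socle_irr a))).
  by apply/centgmxP => g _; rewrite -!repr_mxM // minus1_central.
have : irr_repr a (z * z)%g = 1%:M by rewrite minus1_square repr_mx1.
have da : (0 < d a)%N := irr_degree_gt0 a.
rewrite /parity repr_mxM // sE -scalar_mxM => ss.
have /eqP : s * s = 1.
  by have /matrixP/(_ (Ordinal da) (Ordinal da)) := ss; rewrite !mxE eqxx.
rewrite -expr2 sqrf_eq1 => /orP[]/eqP->; first by rewrite eqxx.
have -> // : (-1)%:M != 1%:M :> 'M[K]_(d a).
apply/eqP => /matrixP/(_ (Ordinal da) (Ordinal da)); rewrite !mxE eqxx => /eqP.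
by rewrite eq_sym -subr_eq0 opprK -[X in X == 0]/(2%:R) pnatr_eq0.
Qed.

Lemma irr_chi_z a g : irr_chi a (z * g)%g = (-1) ^+ parity a * irr_chi a g.
Proof. by rewrite /irr_chi repr_mxM // irr_repr_z mul_scalar_mx linearZ. Qed.

(** The element -1 acts on V (x) V_a by minus its sign on V_a. *)
Lemma mckay_parity a b : (0 < m a b)%N -> parity b = ~~ parity a.
Proof.
move=> mab; have : N * (m a b)%:R != 0 by rewrite mulf_neq0 // pnatr_eq0 -lt0n.
have zV : z^-1%g = z by apply: (mulgI z); rewrite mulgV minus1_square.
have : N * (m a b)%:R = - (-1) ^+ (parity b (+) parity a) * (N * (m a b)%:R).
  rewrite -mckay_inner mulr_sumr (reindex_inj (mulgI z)) /=.
  apply: eq_bigr => g _.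
  rewrite invMg zV -minus1_central !irr_chi_z /chiV repr_mxM // rV_z.
  rewrite mulNmx mul1mx linearN /=.
  rewrite signr_addb.
  move: (_ ^+ _) (_ ^+ _) (irr_chi _ _) (irr_chi _ _) (\tr _) => s t x y w.
  by ring.
move: (N * _) => t tE; apply: contraNeq => ne_par.
have eq_par : parity b (+) parity a = false.
  by case: (parity b) (parity a) ne_par => [] [].
move: tE; rewrite eq_par expr0 mulN1r => /eqP.
by rewrite -subr_eq0 opprK -mulr2n mulrn_eq0.
Qed.

(** The trivial representation, an odd neighbour b of it and nothing else
    would be impossible: at g different from 1 and -1 the regular character
    vanishes both at g and at -g, so 1 + d_b chi_b(g) and 1 - d_b chi_b(g) are
    both 0.
    A double edge a - b would force d_a = d_b and leave a and b without other
    neighbours, against connectedness. *)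
Lemma mckay_admissible :
  zigzag_admissible (@mckay_edges K gT [set: gT]%G sG 2 rV).
Proof.
have loops a : m a a = 0%N.
  by apply/eqP; rewrite -leqn0 leqNgt; apply/negP=> /mckay_parity; case: parity.
have neighbor a : exists b, (0 < m a b)%N.
  apply: contrapT => no; have := irr_degree_gt0 a.
  rewrite lt0n -(eqn_pmul2l (isT : 0 < 2)%N) -mckay_degree muln0 big1 // => b _.
  apply/eqP; rewrite muln_eq0 eqn0Ngt; apply/orP; left; apply/negP=> mab.
  by apply: no; exists b.
have parity1 : parity (principal_comp sG) = false.
  by rewrite /parity irr1_repr ?inG ?eqxx //; apply: pchar_group.
have more2 : (2 < #|sG|)%N.
  rewrite ltnNge; apply/negP=> le2.
  have [b b1] := neighbor (principal_comp sG).
  have pb : parity b by rewrite (mckay_parity b1) parity1.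
  have nb : b != principal_comp sG.
    by apply: contraTneq pb => ->; rewrite parity1.
  have two c : c \in [set principal_comp sG; b].
    have/setP/(_ c) : [set principal_comp sG; b] = setT;
      last by rewrite in_setT.
    by apply/eqP; rewrite eqEcard subsetT cardsT cards2 eq_sym nb.
  have [g] := more_than_pm1; rewrite !inE negb_or => /andP[g1 gz].
  have sumE h : \sum_(c : sG) (d c)%:R * irr_chi c h
      = irr_chi (principal_comp sG) h *+ d (principal_comp sG)
        + (d b)%:R * irr_chi b h.
    rewrite (bigD1 (principal_comp sG)) //= (bigD1 b) //= big1 => [|c].
      by rewrite addr0 mulr_natl.
    by have := two c; rewrite !inE => /orP[]/eqP->; rewrite eqxx ?andbF.
  have triv h : irr_chi (principal_comp sG) h *+ d (principal_comp sG) = 1.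
    rewrite /irr_chi irr1_repr ?inG //.
    by rewrite mxtrace1 degree_irr1.
  have zg1 : (z * g)%g != 1%g by rewrite -minus1_square (inj_eq (mulgI z)).
  have := irr_chi_regular sG g; rewrite sumE triv (negPf g1) => E1.
  have := irr_chi_regular sG (z * g)%g; rewrite sumE triv (negPf zg1).
  rewrite irr_chi_z pb mulN1r mulrN => E2.
  have := congr2 +%R E1 E2; rewrite addr0 addrACA addrN addr0 => /eqP.
  by rewrite -[X in X == 0]/(2%:R) pnatr_eq0.
have conn a b : connect (fun x y => (0 < m x y)%N) a b.
  apply: (mckay_closed (connect0 _ a)) => c b' ac cb.
  exact: connect_trans ac (connect1 cb).
split=> //; first exact: mckay_sym.
move=> a b; rewrite leqNgt; apply/negP=> mab.
have term c c' : (m c c' * d c' <= 2 * d c)%N.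
  by rewrite -mckay_degree (bigD1 c') //= leq_addr.
have le_ab c c' : (1 < m c c')%N -> (d c' <= d c)%N.
  by move=> mcc; rewrite -(leq_pmul2l (isT : 0 < 2)%N);
     apply: leq_trans (term c c'); rewrite leq_mul2r mcc orbT.
(* A double edge exhausts the degree identity at both of its ends. *)
have only c c' e : (1 < m c c')%N -> (0 < m c e)%N -> e = c'.
  move=> mcc mce; apply/eqP; apply: contraT => nec.
  have dcc : d c = d c'.
    by apply/eqP; rewrite eqn_leq !le_ab //; rewrite mckay_sym.
  have := mckay_degree c; rewrite (bigD1 c') //= (bigD1 e) //= => E.
  have : (2 * d c' + m c e * d e <= 2 * d c)%N.
    by rewrite -E leq_add ?leq_addr // leq_mul2r mcc orbT.
  rewrite dcc -[leqRHS]addn0 leq_add2l leqn0 muln_eq0 !eqn0Ngt mce.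
  by rewrite irr_degree_gt0.
have : #|sG| = #|[set a; b]|.
  rewrite -cardsT; congr #|pred_of_set _|; apply/setP=> c; rewrite in_setT.
  apply/esym.
  apply: (@mckay_closed [pred c | c \in [set a; b]] a _ _ c) => [|c' e] /=.
    by rewrite set21.
  case/set2P=> -> ce; first by rewrite (only _ _ _ mab ce) set22.
  by rewrite (only b a e) ?set21 // mckay_sym.
by rewrite cards2 => E; move: more2; rewrite E; case: (a != b).
Qed.
End McKayGraph.

(** * Graded components of the crossed product *)

Section GroupConvolution.
Variables (K : numClosedFieldType) (gT : finGroupType).
Implicit Types (u v : gT -> K).

(** The product of the group algebra. *)
Definition conv u v : gT -> K := fun k => \sum_h u h * v (h^-1 * k)%g.

Lemma group_eval_conv n (r : mx_representation K [set: gT] n) u v :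
  group_eval r (conv u v) = group_eval r u *m group_eval r v.
Proof.
rewrite /group_eval mulmx_suml; under eq_bigr do rewrite scaler_suml.
rewrite exchange_big; apply: eq_bigr => h _; rewrite mulmx_sumr.
rewrite (reindex_inj (mulgI h)); apply: eq_bigr => k _.
by rewrite mulKg -scalemxAl -scalemxAr scalerA repr_mxM ?inE.
Qed.

Lemma eq_group_eval n (r : mx_representation K [set: gT] n) u v :
  u =1 v -> group_eval r u = group_eval r v.
Proof. by move=> uv; apply: eq_bigr => g _; rewrite uv. Qed.

Lemma group_eval_sum n (r : mx_representation K [set: gT] n) (I : finType)
    (F : I -> gT -> K) :
  group_eval r (fun g => \sum_i F i g) = \sum_i group_eval r (F i).
Proof.
by rewrite /group_eval exchange_big; apply: eq_bigr => g _; rewrite scaler_suml.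
Qed.

Lemma group_evalZ n (r : mx_representation K [set: gT] n) k u :
  group_eval r (fun g => k * u g) = k *: group_eval r u.
Proof. by rewrite scaler_sumr; apply: eq_bigr => g _; rewrite scalerA. Qed.

Lemma group_eval0 n (r : mx_representation K [set: gT] n) u :
  (forall g, u g = 0) -> group_eval r u = 0.
Proof. by move=> u0; apply: big1 => g _; rewrite u0 scale0r. Qed.
End GroupConvolution.

Section CrossedComponents.
Variables (K : numClosedFieldType) (gT : finGroupType).
Variable rV : mx_representation K [set: gT] 2.
Hypothesis rV_det : forall g, \det (rV g) = 1.
Local Notation B := (crossed rV).
Implicit Types (u v : gT -> K) (x y : B) (g h : gT).

Definition deg0 x g : K := (x g).1.1.
Definition deg1 (i : 'I_2) x g : K := (x g).1.2 i 0.
Definition deg2 x g : K := (x g).2.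

Lemma crossed_ext x y : deg0 x =1 deg0 y -> (forall i, deg1 i x =1 deg1 i y) ->
  deg2 x =1 deg2 y -> x = y.
Proof.
move=> e0 e1 e2; apply/ffunP=> g; apply: ext2P; [exact: e0| |exact: e2].
by apply: cV2P; apply: e1.
Qed.

Definition group_el u : B := [ffun g => (u g, 0, 0) : ext2 K].
(** The element w u, where w is the generator of the top exterior power. *)
Definition top_el u : B := [ffun g => (0, 0, u g) : ext2 K].
Definition part1 x : B := [ffun g => (0, (x g).1.2, 0) : ext2 K].

Lemma ext2_sum0 (I : finType) (F : I -> ext2 K) :
  (\sum_i F i).1.1 = \sum_i (F i).1.1.
Proof. exact: (big_morph (fun x : ext2 K => x.1.1)). Qed.
Lemma ext2_sum1 (I : finType) (F : I -> ext2 K) i :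
  (\sum_i F i).1.2 i 0 = \sum_j (F j).1.2 i 0.
Proof.
by apply: (big_morph (fun x : ext2 K => x.1.2 i 0)) => [x y|]; rewrite ?mxE.
Qed.
Lemma ext2_sum2 (I : finType) (F : I -> ext2 K) :
  (\sum_i F i).2 = \sum_i (F i).2.
Proof. exact: (big_morph (fun x : ext2 K => x.2)). Qed.

Lemma mul_group_el u x k :
  (group_el u * x) k = \sum_h u h *: ext2_act (rV h) (x (h^-1 * k)%g).
Proof.
rewrite [LHS]ffunE; apply: eq_bigr => h _; rewrite ffunE ext2_mulE ext2_scaleE.
apply: ext2P => //=; first by rewrite scaler0 addr0.
by rewrite mul0r addr0 /wedge2 !mxE !mul0r subrr addr0.
Qed.

Lemma mul_el_group x u k : (x * group_el u) k = \sum_h u (h^-1 * k)%g *: x h.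
Proof.
rewrite [LHS]ffunE; apply: eq_bigr => h _; rewrite ffunE ext2_mulE ext2_scaleE.
rewrite /ext2_act /ext2_mul mulmx0 !mulr0 /=; apply: ext2P => /=.
- by rewrite mulrC.
- by rewrite scaler0 add0r.
- by rewrite add0r mulrC /wedge2 !mxE !mulr0 subrr addr0.
Qed.

Section Eval.
Variables (n : nat) (r : mx_representation K [set: gT] n).

Lemma eval_deg0_l u x :
  group_eval r (deg0 (group_el u * x))
  = group_eval r u *m group_eval r (deg0 x).
Proof.
rewrite -group_eval_conv; apply: eq_group_eval => k.
by rewrite /deg0 mul_group_el ext2_sum0.
Qed.
Lemma eval_deg2_l u x :
  group_eval r (deg2 (group_el u * x))
  = group_eval r u *m group_eval r (deg2 x).
Proof.
rewrite -group_eval_conv; apply: eq_group_eval => k.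
rewrite /deg2 mul_group_el ext2_sum2; apply: eq_bigr => h _.
by rewrite ext2_scaleE /= rV_det mul1r.
Qed.
(** In degree 1 the group acts on the left through V (x) r, whose matrix is made
    of the blocks (rV i j) r. *)
Lemma eval_deg1_l i u x :
  group_eval r (deg1 i (group_el u * x))
  = \sum_j group_eval r (fun h => u h * rV h i j) *m group_eval r (deg1 j x).
Proof.
under eq_bigr do rewrite -group_eval_conv.
rewrite -group_eval_sum; apply: eq_group_eval => k.
rewrite /deg1 mul_group_el ext2_sum1 exchange_big; apply: eq_bigr => h _.
rewrite ext2_scaleE /= !mxE mulr_sumr; apply: eq_bigr => j _.
by rewrite mulrA.
Qed.
Lemma eval_deg0_r u x :
  group_eval r (deg0 (x * group_el u))
  = group_eval r (deg0 x) *m group_eval r u.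
Proof.
rewrite -group_eval_conv; apply: eq_group_eval => k.
by rewrite /deg0 mul_el_group ext2_sum0; apply: eq_bigr => h _; rewrite mulrC.
Qed.
Lemma eval_deg2_r u x :
  group_eval r (deg2 (x * group_el u))
  = group_eval r (deg2 x) *m group_eval r u.
Proof.
rewrite -group_eval_conv; apply: eq_group_eval => k.
by rewrite /deg2 mul_el_group ext2_sum2; apply: eq_bigr => h _; rewrite mulrC.
Qed.
Lemma eval_deg1_r i u x :
  group_eval r (deg1 i (x * group_el u))
  = group_eval r (deg1 i x) *m group_eval r u.
Proof.
rewrite -group_eval_conv; apply: eq_group_eval => k.
rewrite /deg1 mul_el_group ext2_sum1; apply: eq_bigr => h _.
by rewrite ext2_scaleE mxE mulrC.
Qed.
End Eval.

Lemma group_elM u v : group_el u * group_el v = group_el (conv u v).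
Proof.
apply/ffunP=> k; rewrite mul_group_el ffunE; apply: ext2P => /=.
- by rewrite ext2_sum0; apply: eq_bigr => h _; rewrite ffunE.
- apply/matrixP=> i j; rewrite (ord1 j) ext2_sum1 big1 ?mxE // => h _.
  by rewrite ffunE ext2_scaleE /= mulmx0 scaler0 mxE.
by rewrite ext2_sum2 big1 // => h _; rewrite ffunE ext2_scaleE /= !mulr0.
Qed.

(** The elements of exterior degree 1. *)
Definition homogeneous1 x := forall g, (x g).1.1 = 0 /\ (x g).2 = 0.

Lemma homogeneous1_mul x y g : homogeneous1 x -> homogeneous1 y ->
  (x * y) g = (0, 0, \sum_h wedge2 (x h).1.2 (rV h *m (y (h^-1 * g)%g).1.2)).
Proof.
move=> hx hy; rewrite [LHS]ffunE.
rewrite (eq_bigr (fun h =>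
  (0, 0, wedge2 (x h).1.2 (rV h *m (y (h^-1 * g)%g).1.2)) : ext2 K)).
  apply: ext2P; rewrite ?ext2_sum0 ?ext2_sum2 //=; first by rewrite big1.
  apply/matrixP=> i j; rewrite (ord1 j) ext2_sum1 big1 ?mxE // => h _.
  by rewrite mxE.
move=> h _; rewrite ext2_mulE; apply: ext2P => /=; rewrite (hx h).1 ?(hx h).2.
- by rewrite mul0r.
- by rewrite (hy _).1 !scale0r addr0.
by rewrite mul0r add0r mul0r add0r.
Qed.

(** The form tau: on products of two elements of degree 1 it is a nondegenerate
    trace up to sign. *)
Definition top_trace x : K := deg2 x 1%g.

Lemma top_trace_mul x y : homogeneous1 x -> homogeneous1 y ->
  top_trace (x * y) = \sum_h wedge2 (x h).1.2 (rV h *m (y h^-1%g).1.2).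
Proof.
move=> hx hy; rewrite /top_trace /deg2 homogeneous1_mul //=.
by apply: eq_bigr => h _; rewrite mulg1.
Qed.

Lemma wedge2C (v w : 'cV[K]_2) : wedge2 v w = - wedge2 w v.
Proof. by rewrite /wedge2 opprB mulrC [v 1 0 * _]mulrC. Qed.

Lemma wedge2_det (g : 'M[K]_2) (v w : 'cV[K]_2) :
  wedge2 (g *m v) (g *m w) = \det g * wedge2 v w.
Proof. by rewrite det2 /wedge2 !mxE !sum2; ring. Qed.

(** The sign is that of the exterior product of two vectors, and the
    determinant 1 makes that product G-invariant. *)
Lemma top_trace_anti x y : homogeneous1 x -> homogeneous1 y ->
  top_trace (x * y) = - top_trace (y * x).
Proof.
move=> hx hy; rewrite !top_trace_mul // (reindex_inj invg_inj) /= -sumrN.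
apply: eq_bigr => h _; rewrite invgK wedge2C; congr (- _).
rewrite -[LHS]mul1r -(rV_det h) -wedge2_det mulmxA -repr_mxM ?inE //.
by rewrite mulgV repr_mx1 mul1mx.
Qed.

Lemma top_traceC u x : top_trace (group_el u * x) = top_trace (x * group_el u).
Proof.
rewrite /top_trace /deg2 mul_group_el mul_el_group !ext2_sum2.
rewrite (reindex_inj invg_inj); apply: eq_bigr => h _.
by rewrite !ext2_scaleE /= rV_det mul1r invgK !mulg1.
Qed.

(** If x has the vector v <> 0 at h, pair it with (h^-1 w) h^-1 where v and w
    are independent. *)
Lemma top_trace_nondeg x : homogeneous1 x -> x != 0 ->
  exists2 y, homogeneous1 y & top_trace (x * y) != 0.
Proof.
move=> hx nx; have [h xh] : exists h, (x h).1.2 != 0.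
  apply/existsP; apply: contraR nx; rewrite negb_exists => /forallP x0.
  apply/eqP/ffunP=> g; rewrite [RHS]ffunE.
  apply: ext2P; rewrite ?(hx g).1 ?(hx g).2 //.
  by apply/eqP; rewrite -[_ == _]negbK.
have [w nw] : exists w, wedge2 (x h).1.2 w != 0.
  have [v0|nv0] := eqVneq ((x h).1.2 0 0) 0; last first.
    by exists (delta_mx 1 0); rewrite /wedge2 !mxE /= mulr1 mulr0 subr0.
  exists (delta_mx 0 0); rewrite /wedge2 !mxE /= mulr0 mulr1 sub0r oppr_eq0.
  apply: contraNneq xh => v1; apply/eqP/cV2P; rewrite mxE //.
exists (crossed_tens rV (0, rV h^-1%g *m w, 0) h^-1%g).
  by move=> g; rewrite ffunE; case: eqP.
rewrite top_trace_mul //; last by move=> g; rewrite ffunE; case: eqP.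
rewrite (bigD1 h) //= big1 ?addr0 => [|g ngh].
  by rewrite ffunE eqxx /= mulmxA -repr_mxM ?inE // mulgV repr_mx1 mul1mx.
rewrite ffunE (inj_eq invg_inj) (negPf ngh) /= mulmx0 /wedge2 !mxE.
by rewrite !mulr0 subrr.
Qed.
End CrossedComponents.

(** * Vertex idempotents and their corners *)

(** Through a rank factorization P = C R, with R C = 1 when P is
    idempotent. *)
Lemma mxtrace_idempotent (K : fieldType) n (P : 'M[K]_n) :
  P *m P = P -> \tr P = (\rank P)%:R.
Proof.
move=> PP; rewrite -{1}(mulmx_base P) mxtrace_mulC.
suffices -> : row_base P *m col_base P = 1%:M by rewrite mxtrace1.
have rfree : row_free (row_base P) := row_base_free P.
have cfull : row_full (col_base P) := col_base_full P.
apply: (row_full_inj cfull); apply: (row_free_inj rfree).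
by rewrite mulmx1 mulmxA mulmx_base -mulmxA mulmx_base PP.
Qed.

Lemma rank1_idempotent (K : fieldType) n (P : 'M[K]_n) :
    P *m P = P -> (\rank P <= 1)%N ->
  exists C : 'cV[K]_n,
    [/\ P *m C = C, forall Y : 'cV_n, exists k, P *m Y = k *: C
      & C = 0 -> P = 0].
Proof.
move=> PP rP; have [P0|nP] := eqVneq P 0.
  exists 0; split=> [|Y|]; rewrite ?P0 ?mul0mx //.
  by exists 0; rewrite scaler0.
have r1 : \rank P = 1%N by apply/eqP; rewrite eqn_leq rP lt0n mxrank_eq0.
have [C [r PE]] : exists (C : 'cV_n) (r : 'rV_n), P = C *m r.
  move: (col_base P) (row_base P) (mulmx_base P); rewrite r1 => C r <-.
  by exists C, r.
have PY (Y : 'cV_n) : P *m Y = (r *m Y) 0 0 *: C.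
  by rewrite PE -mulmxA [r *m Y]mx11_scalar mul_mx_scalar !mxE mulr1n.
have nC : C != 0 by apply: contraNneq nP => C0; rewrite PE C0 mul0mx.
exists C; split=> [|Y|C0]; last by rewrite PE C0 mul0mx.
  rewrite PY; suffices -> : (r *m C) 0 0 = 1 by rewrite scale1r.
  apply/eqP; rewrite -subr_eq0; have := PP.
  rewrite {2}PE mulmxA PY -scalemxAl -PE => /eqP.
  by rewrite -subr_eq0 -{2}[P]scale1r -scalerBl scaler_eq0 (negPf nP) orbF.
by exists ((r *m Y) 0 0); rewrite PY.
Qed.

Lemma mxtrace_delta (K : fieldType) n (i : 'I_n) :
  \tr (delta_mx i i : 'M[K]_n) = 1.
Proof.
rewrite /mxtrace (bigD1 i) //= mxE eqxx big1 ?addr0 // => j /negPf nji.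
by rewrite mxE nji.
Qed.

Section Arrows.
Variables (K : numClosedFieldType) (gT : finGroupType).
Variable sG : irrType K [set: gT].
Variable rV : mx_representation K [set: gT] 2.
Hypothesis rV_det : forall g, \det (rV g) = 1.
Local Notation B := (crossed rV).
Implicit Types (a b c : sG) (u v : gT -> K) (x y : B) (g h : gT).
Local Notation m a b := (@mckay_edges K gT [set: gT]%G sG 2 rV a b).
Local Notation d a := (irr_degree a).
Local Notation ev c := (group_eval (irr_repr c)).

Definition ord_base a : 'I_(d a) := Ordinal (irr_degree_gt0 a).
Local Notation o := (ord_base _).

(** The matrix unit E_ij of the block of V_a in the group algebra. *)
Definition irr_unit a (i j : 'I_(d a)) : gT -> K :=
  projT1 (cid (irr_eval_onto (delta_mx i j : 'M_(d a)))).
Lemma irr_unitE a i j : ev a (@irr_unit a i j) = delta_mx i j.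
Proof. exact: (projT2 (cid (irr_eval_onto (delta_mx i j : 'M_(d a))))).1. Qed.
Lemma irr_unitN a i j c : c != a -> ev c (@irr_unit a i j) = 0.
Proof. exact: (projT2 (cid (irr_eval_onto (delta_mx i j : 'M_(d a))))).2. Qed.

Local Notation prim a := (irr_unit (ord_base a) (ord_base a)).
Definition vertex_el a : B := group_el rV (prim a).
Local Notation e := vertex_el.

Lemma group_el_inj u v :
  (forall c : sG, ev c u = ev c v) -> group_el rV u = group_el rV v.
Proof. by move=> uv; apply/ffunP=> g; rewrite !ffunE (irr_eval_inj uv). Qed.

Lemma vertex_orth a b : e a * e b = if a == b then e a else 0.
Proof.
have z0 : 0 = group_el rV (fun _ => 0) by apply/ffunP=> g; rewrite !ffunE.
rewrite group_elM.
case: eqP => [<-|/eqP nab]; rewrite ?z0; apply: group_el_inj => c.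
  rewrite group_eval_conv; have [->|nca] := eqVneq c a.
    by rewrite irr_unitE mul_delta_mx.
  by rewrite irr_unitN // mul0mx.
rewrite group_eval_conv [RHS]group_eval0 //.
have [->|nca] := eqVneq c a; last by rewrite irr_unitN // mul0mx.
by rewrite [X in _ *m X]irr_unitN // mulmx0.
Qed.

Lemma conv_prim a : conv (prim a) (prim a) = prim a.
Proof.
apply/funext; apply: (irr_eval_inj (sG := sG)) => c; rewrite group_eval_conv.
have [->|nca] := eqVneq c a; first by rewrite irr_unitE mul_delta_mx.
by rewrite irr_unitN // mul0mx.
Qed.

(** By Fourier inversion, as e_a has trace 1 on V_a and 0 elsewhere. *)
Lemma prim_at1 a : #|gT|%:R * prim a 1%g = (d a)%:R.
Proof.
rewrite -(group_eval_coeff sG) (bigD1 a) //= big1 => [|c nca].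
  by rewrite irr_unitE invg1 repr_mx1 mulmx1 addr0 mxtrace_delta mulr1.
by rewrite irr_unitN // mul0mx mxtrace0 mulr0.
Qed.

(** The units E_i0 and E_0i of the blocks express 1 as a sum of E_i0 e E_0i, so
    the vertex idempotents generate B as a two-sided ideal. *)
Lemma vertex_full :
  \sum_(i : {a : sG & 'I_(d a)})
    group_el rV (irr_unit (tagged i) (ord_base (tag i))) * (\sum_b e b)
      * group_el rV (irr_unit (ord_base (tag i)) (tagged i)) = 1.
Proof.
rewrite (eq_bigr (fun i : {a : sG & 'I_(d a)} =>
   group_el rV (irr_unit (tagged i) (tagged i)))); last first.
  move=> [a i] _ /=; rewrite mulr_sumr (bigD1 a) //= big1 ?addr0 => [|b nba].
    rewrite !group_elM; apply: group_el_inj => c; rewrite !group_eval_conv.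
    have [->|nca] := eqVneq c a; first by rewrite !irr_unitE !mul_delta_mx.
    by rewrite !irr_unitN // !mul0mx.
  have -> : 0 = group_el rV (fun _ => 0) by apply/ffunP=> g; rewrite !ffunE.
  rewrite group_elM; apply: group_el_inj => c.
  rewrite group_eval_conv [RHS]group_eval0 //.
  have [->|nca] := eqVneq c a; last by rewrite irr_unitN // mul0mx.
  by rewrite [X in _ *m X]irr_unitN 1?eq_sym // mulmx0.
(* The diagonal matrix units of all the blocks add up to 1. *)
pose S g := \sum_(i : {a : sG & 'I_(d a)}) irr_unit (tagged i) (tagged i) g.
have -> : 1 = group_el rV (fun g => (g == 1%g)%:R).
  by apply/ffunP=> g; rewrite !ffunE; case: eqP.
transitivity (group_el rV S).
  apply: crossed_ext => [g|i g|g]; rewrite /deg0 /deg1 /deg2 sum_ffunE.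
  - by rewrite ext2_sum0 ffunE; apply: eq_bigr => j _; rewrite ffunE.
  - by rewrite ext2_sum1 ffunE mxE big1 // => j _; rewrite ffunE mxE.
  - by rewrite ext2_sum2 ffunE big1 // => j _; rewrite ffunE.
apply: group_el_inj => c; rewrite group_eval_sum.
have -> : ev c (fun g => (g == 1%g)%:R) = 1%:M.
  rewrite /group_eval (bigD1 1%g) //= eqxx scale1r repr_mx1 big1 ?addr0 //.
  by move=> g /negPf->; rewrite scale0r.
rewrite -(sig_big_dep predT (fun=> predT)
   (fun a i => ev c (irr_unit i i))) /= (bigD1 c) //= [X in _ + X]big1 ?addr0.
  under eq_bigr do rewrite irr_unitE.
  by rewrite [RHS]mx1_sum_delta.
by move=> a nac; apply: big1 => i _; rewrite irr_unitN // eq_sym.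
Qed.

(** An element is determined by the action of its coefficients on the
    irreducible representations. *)
Lemma eval_ext x y : (forall c, ev c (deg0 x) = ev c (deg0 y)) ->
  (forall c i, ev c (deg1 i x) = ev c (deg1 i y)) ->
  (forall c, ev c (deg2 x) = ev c (deg2 y)) -> x = y.
Proof.
by move=> e0 e1 e2; apply: crossed_ext => [|i|];
   apply: (irr_eval_inj (sG := sG)) => c.
Qed.

Lemma corner_delta a b c (M : 'M[K]_(d c)) :
  ev c (prim a) *m M *m ev c (prim b)
  = if (c == a) && (c == b) then M o o *: delta_mx o o else 0.
Proof.
have [eca|nca] := eqVneq c a; last by rewrite irr_unitN // !mul0mx.
have [ecb|ncb] := eqVneq c b; last by rewrite [X in _ *m X]irr_unitN // mulmx0.
case: a / eca; case: b / ecb => /=; rewrite irr_unitE.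
apply/matrixP=> i j; rewrite !mxE (bigD1 o) //= big1 ?addr0; last first.
  by move=> k nk; rewrite !mxE (negPf nk) mulr0.
rewrite !mxE eqxx (bigD1 o) //= big1 ?addr0 => [|k nk]; last first.
  by rewrite !mxE (negPf nk) andbF mul0r.
rewrite mxE eqxx andbT.
by case: eqP; case: eqP; rewrite /= ?mul0r ?mul1r ?mulr0 ?mulr1.
Qed.

Definition vertex_top a : B := top_el rV (prim a).

(** In degrees 0 and 2 the compression between e_a and e_b acts on each V_c as
    the compression of a matrix between two units E_00, hence as a multiple of
    E_00, and as 0 unless a = b = c. *)
Lemma vertex_corner a b x : exists k0 k2,
  e a * x * e b = (if a == b then k0 *: e a + k2 *: vertex_top a else 0)
                  + e a * part1 x * e b /\
  ((forall g, (x g).1.1 = 0) -> k0 = 0).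
Proof.
exists (ev a (deg0 x) o o), (ev a (deg2 x) o o); split; last first.
  by move=> x0; rewrite group_eval0 // mxE.
have partE0 : forall g, ((e a * part1 x * e b) g).1.1 = 0.
  change (deg0 (e a * part1 x * e b) =1 fun=> 0).
  apply: (irr_eval_inj (sG := sG)) => c; rewrite eval_deg0_r eval_deg0_l.
  have -> : ev c (deg0 (part1 x)) = 0.
    by apply: group_eval0 => g; rewrite /deg0 ffunE.
  by rewrite mulmx0 mul0mx [RHS]group_eval0.
have partE2 : forall g, ((e a * part1 x * e b) g).2 = 0.
  change (deg2 (e a * part1 x * e b) =1 fun=> 0).
  apply: (irr_eval_inj (sG := sG)) => c; rewrite eval_deg2_r eval_deg2_l //.
  have -> : ev c (deg2 (part1 x)) = 0.
    by apply: group_eval0 => g; rewrite /deg2 ffunE.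
  by rewrite mulmx0 mul0mx [RHS]group_eval0.
set D := (if _ then _ else _).
have D0 : deg0 (D + e a * part1 x * e b)
    = (fun g => if a == b then ev a (deg0 x) o o * prim a g else 0).
  apply/funext=> g; rewrite /deg0 crossedDE ext2_addE /= partE0 addr0.
  rewrite /D; case: eqP => _; last by rewrite ffunE.
  rewrite crossedDE !crossedZE /vertex_el /vertex_top !ffunE /=.
  by rewrite scaler0 addr0.
have D2 : deg2 (D + e a * part1 x * e b)
    = (fun g => if a == b then ev a (deg2 x) o o * prim a g else 0).
  apply/funext=> g; rewrite /deg2 crossedDE ext2_addE /= partE2 addr0.
  rewrite /D; case: eqP => _; last by rewrite ffunE.
  rewrite crossedDE !crossedZE /vertex_el /vertex_top !ffunE /=.
  by rewrite scaler0 add0r.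
have evD (M : forall c, 'M[K]_(d c)) c :
    ev c (prim a) *m M c *m ev c (prim b)
    = ev c (fun g => if a == b then M a o o * prim a g else 0).
  rewrite corner_delta; have [<-|nab] := eqVneq a b; last first.
    rewrite [RHS]group_eval0 //; have [->|nca //] := eqVneq c a.
    by rewrite (negPf nab).
  rewrite andbb group_evalZ.
  have [->|nca] := eqVneq c a; first by rewrite irr_unitE.
  by rewrite irr_unitN // scaler0.
apply: eval_ext => [c|c i|c].
- by rewrite eval_deg0_r eval_deg0_l D0 -(evD (fun c => ev c (deg0 x))).
- have -> : deg1 i (D + e a * part1 x * e b) = deg1 i (e a * part1 x * e b).
    apply/funext=> g; rewrite /deg1 crossedDE ext2_addE /= mxE.
    rewrite [X in X + _](_ : _ = 0) ?add0r // /D.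
    case: eqP => _; last by rewrite ffunE mxE.
    rewrite crossedDE !crossedZE /vertex_el /vertex_top !ffunE /=.
    by rewrite !scaler0 addr0 mxE.
  rewrite !eval_deg1_r !eval_deg1_l; congr (_ *m _); apply: eq_bigr => j _.
  by congr (_ *m _); apply: eq_group_eval => g; rewrite /deg1 ffunE.
by rewrite eval_deg2_r eval_deg2_l // D2 -(evD (fun c => ev c (deg2 x))).
Qed.

Section TwistedRepresentation.
Variable b : sG.
Local Notation rb := (irr_repr b).

(** The representation V (x) V_b in block form. *)
Definition twist_mx g : 'M[K]_(d b + d b) :=
  block_mx (rV g 0 0 *: rb g) (rV g 0 1 *: rb g)
           (rV g 1 0 *: rb g) (rV g 1 1 *: rb g).

Fact twist_mx_repr : mx_repr [set: gT] twist_mx.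
Proof.
split=> [|g h _ _]; rewrite /twist_mx.
  by rewrite !repr_mx1 !mxE /= !scale0r !scale1r scalar_mx_block.
rewrite !repr_mxM ?inE // mulmx_block !mxE !sum2.
by rewrite -!scalemxAl -!scalemxAr !scalerA !scalerDl.
Qed.
Definition twist := MxRepresentation twist_mx_repr.

Lemma eval_twist u : group_eval twist u =
  block_mx (group_eval rb (fun g => u g * rV g 0 0))
           (group_eval rb (fun g => u g * rV g 0 1))
           (group_eval rb (fun g => u g * rV g 1 0))
           (group_eval rb (fun g => u g * rV g 1 1)).
Proof.
rewrite /group_eval; elim: (index_enum _) => [|g s IHs].
  by rewrite !big_nil block_mx0.
by rewrite !big_cons IHs scale_block_mx add_block_mx !scalerA.
Qed.

(** The trace of e_a on a representation is the multiplicity of V_a. *)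
Lemma trace_twist a : \tr (group_eval twist (prim a)) = (m b a)%:R.
Proof.
have chiE g : \tr (twist g) = \sum_c (m b c)%:R * irr_chi c g.
  by rewrite -mckay_trace /= mxtrace_block !linearZ /= -mulrDl /mxtrace sum2.
have := trace_group_eval twist (prim a) 1%g; rewrite repr_mx1 mulmx1 => ->.
under eq_bigr do rewrite mulg1 chiE mulr_sumr.
rewrite exchange_big (bigD1 a) //= [X in _ + X]big1 ?addr0 => [|c nca].
  under eq_bigr do rewrite mulrCA.
  rewrite -mulr_sumr; have := trace_group_eval (irr_repr a) (prim a) 1%g.
  rewrite repr_mx1 mulmx1 irr_unitE mxtrace_delta.
  by under eq_bigr do rewrite mulg1; move=> <-; rewrite mulr1.
under eq_bigr do rewrite mulrCA.
rewrite -mulr_sumr; have := trace_group_eval (irr_repr c) (prim a) 1%g.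
rewrite repr_mx1 mulmx1 irr_unitN // mxtrace0.
by under eq_bigr do rewrite mulg1; move=> <-; rewrite mulr0.
Qed.

(** An element of degree 1 compressed by e_b on the right is determined by a
    vector of V (x) V_b: the first column of its action, as all the others
    vanish. *)
Definition arrow_col x : 'cV[K]_(d b + d b) :=
  col_mx (col o (ev b (deg1 0 x))) (col o (ev b (deg1 1 x))).

Lemma arrow_colZ k x : arrow_col (k *: x) = k *: arrow_col x.
Proof.
have evZ i : ev b (deg1 i (k *: x)) = k *: ev b (deg1 i x).
  rewrite -group_evalZ; apply: eq_group_eval => g.
  by rewrite /deg1 crossedZE ext2_scaleE mxE.
by rewrite /arrow_col scale_col_mx !evZ !linearZ.
Qed.

Lemma arrow_col_corner a x :
  arrow_col (e a * x * e b) = group_eval twist (prim a) *m arrow_col x.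
Proof.
rewrite eval_twist mul_block_col /arrow_col.
have colE i : col o (ev b (deg1 i (e a * x * e b)))
    = \sum_j ev b (fun g => prim a g * rV g i j) *m col o (ev b (deg1 j x)).
  rewrite eval_deg1_r eval_deg1_l irr_unitE !colE -mulmxA.
  rewrite mul_delta_mx.
  by rewrite mulmx_suml; apply: eq_bigr => j _; rewrite colE mulmxA.
by rewrite !colE !sum2.
Qed.

Lemma arrow_col_inj a a' x y : homogeneous1 x -> homogeneous1 y ->
  e a * x * e b = x -> e a' * y * e b = y -> arrow_col x = arrow_col y -> x = y.
Proof.
move=> hx hy xE yE /eq_col_mx[E0 E1].
have evE (t : B) c i :
    ev c (deg1 i (t * e b)) = ev c (deg1 i t) *m ev c (prim b).
  exact: eval_deg1_r.
apply: eval_ext => [c|c i|c]; last 1 first.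
- by rewrite !group_eval0 // => g; [apply: (hy g).2 | apply: (hx g).2].
- by rewrite !group_eval0 // => g; [apply: (hy g).1 | apply: (hx g).1].
have right_e (s : sG) (t : B) : e s * t * e b = t -> t * e b = t.
  by move=> <-; rewrite -mulrA vertex_orth eqxx.
rewrite -(right_e _ _ xE) -(right_e _ _ yE) !evE.
have [ecb|ncb] := eqVneq c b; last by rewrite !irr_unitN // !mulmx0.
rewrite ecb irr_unitE -(mul_delta_mx (0 : 'I_1)) !mulmxA -!colE; congr (_ *m _).
have [->|->] // : i = 0 \/ i = 1.
by case: i {evE} => [[|[|//]] ?]; [left | right]; apply/val_inj.
Qed.
End TwistedRepresentation.
End Arrows.

(** * Arrow spaces *)

Section ArrowSpaces.
Variables (K : numClosedFieldType) (gT : finGroupType).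
Variable sG : irrType K [set: gT].
Variable rV : mx_representation K [set: gT] 2.
Local Notation B := (crossed rV).
Implicit Types (a b c : sG) (u v : gT -> K) (x y : B) (g h : gT).
Local Notation m a b := (@mckay_edges K gT [set: gT]%G sG 2 rV a b).
Local Notation d a := (irr_degree a).
Local Notation ev c := (group_eval (irr_repr c)).
Local Notation e := (vertex_el rV).
Local Notation prim a := (irr_unit (ord_base a) (ord_base a)).

Lemma homogeneous1_group u x v :
  homogeneous1 x -> homogeneous1 (group_el rV u * x * group_el rV v).
Proof.
move=> hx.
have hl : homogeneous1 (group_el rV u * x).
  move=> g; rewrite mul_group_el ext2_sum0 ext2_sum2; split; apply: big1 => h _.
    by rewrite ext2_scaleE /= (hx _).1 mulr0.
  by rewrite ext2_scaleE /= (hx _).2 !mulr0.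
move=> g; rewrite mul_el_group ext2_sum0 ext2_sum2; split; apply: big1 => h _.
  by rewrite ext2_scaleE /= (hl _).1 mulr0.
by rewrite ext2_scaleE /= (hl _).2 mulr0.
Qed.

Lemma homogeneous1_part1 x : homogeneous1 (part1 x).
Proof. by move=> g; rewrite ffunE. Qed.

Lemma homogeneous1Z k x : homogeneous1 x -> homogeneous1 (k *: x).
Proof.
by move=> hx g; rewrite crossedZE ext2_scaleE /= (hx g).1 (hx g).2 !mulr0.
Qed.

Lemma vertex_idem a x b : e a * (e a * x * e b) * e b = e a * x * e b.
Proof. by rewrite !mulrA vertex_orth eqxx -mulrA vertex_orth eqxx. Qed.

Lemma arrow_col_onto b (C : 'cV[K]_(d b + d b)) :
  exists2 x : B, homogeneous1 x & arrow_col b x = C.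
Proof.
have [u0 [u0E _]] := irr_eval_onto (usubmx C *m delta_mx 0 (ord_base b)).
have [u1 [u1E _]] := irr_eval_onto (dsubmx C *m delta_mx 0 (ord_base b)).
exists [ffun g => (0, \col_i (if i == 0 then u0 g else u1 g), 0) : ext2 K].
  by move=> g; rewrite ffunE.
have d11 : delta_mx 0 0 = 1%:M :> 'M[K]_1.
  by apply/matrixP=> i j; rewrite !ord1 !mxE.
rewrite -[RHS]vsubmxK /arrow_col; congr col_mx.
  rewrite (_ : ev b _ = ev b u0); last first.
    by apply: eq_group_eval => g; rewrite /deg1 ffunE mxE.
  by rewrite u0E colE -mulmxA mul_delta_mx d11 mulmx1.
rewrite (_ : ev b _ = ev b u1); last first.
  by apply: eq_group_eval => g; rewrite /deg1 ffunE mxE.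
by rewrite u1E colE -mulmxA mul_delta_mx d11 mulmx1.
Qed.

(** The map arrow_col identifies the degree 1 part of e_a B e_b with the image
    of e_a on V (x) V_b, of dimension m b a. *)
Lemma arrow_ex a b : (m b a <= 1)%N -> exists x,
  [/\ homogeneous1 x, e a * x * e b = x, (x == 0) = (m b a == 0%N)
    & forall y, exists k, e a * part1 y * e b = k *: x].
Proof.
move=> m1; pose P := group_eval (twist rV b) (prim a).
have PP : P *m P = P by rewrite -group_eval_conv conv_prim.
have rP : \rank P = m b a.
  by apply/eqP; rewrite -(eqr_nat K) -mxtrace_idempotent // trace_twist.
have [|C [PC PY C0]] := rank1_idempotent PP; first by rewrite rP.
have [x0 hx0 x0C] := arrow_col_onto C.
(* C is fixed by P, so compressing x0 does not change its column. *)
pose x := e a * x0 * e b.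
have hx : homogeneous1 x by apply: homogeneous1_group.
have xE : e a * x * e b = x by apply: vertex_idem.
have arrow_col0 : arrow_col b (0 : B) = 0.
  by rewrite -(scale0r (0 : B)) arrow_colZ scale0r.
have xC : arrow_col b x = C by rewrite arrow_col_corner x0C.
exists x; split=> // [|y].
  rewrite -rP mxrank_eq0; apply/eqP/eqP=> [x0'|P0].
    by apply: C0; rewrite -xC x0' arrow_col0.
  apply: (@arrow_col_inj K gT sG rV b a a) => //.
  - by move=> g; rewrite ffunE.
  - by rewrite mulr0 mul0r.
  by rewrite arrow_col0 xC -PC P0 mul0mx.
have [k kE] := PY (arrow_col b (part1 y)); exists k.
apply: (@arrow_col_inj K gT sG rV b a a).
- exact/homogeneous1_group/homogeneous1_part1.
- exact: homogeneous1Z.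
- exact: vertex_idem.
- by rewrite -scalerAr -scalerAl xE.
by rewrite arrow_col_corner kE arrow_colZ xC.
Qed.
End ArrowSpaces.

(** * Normalised arrows and the equivalence *)

Lemma corner_absorb (R : pzRingType) (p q r s x y : R) :
    p * p = p -> s * s = s -> p * x * q = x -> r * y * s = y ->
  p * (x * y) * s = x * y.
Proof.
move=> pp ss xE yE; have px : p * x = x by rewrite -xE !mulrA pp.
have ys : y * s = y by rewrite -yE -mulrA ss.
by rewrite mulrA px -mulrA ys.
Qed.

Section McKayMorita.
Variables (K : numClosedFieldType) (gT : finGroupType).
Variable sG : irrType K [set: gT].
Variable rV : mx_representation K [set: gT] 2.
Hypothesis rV_det : forall g, \det (rV g) = 1.
Hypothesis rV_inj : forall g, rV g = 1%:M -> g = 1%g.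
Variable z : gT.
Hypothesis rV_z : rV z = - 1%:M.
Hypothesis adm : zigzag_admissible (@mckay_edges K gT [set: gT]%G sG 2 rV).

Local Notation B := (crossed rV).
Implicit Types (a b c : sG) (x y : B) (g h : gT).
Local Notation m a b := (@mckay_edges K gT [set: gT]%G sG 2 rV a b).
Local Notation e := (vertex_el rV).
Local Notation prim a := (irr_unit (ord_base a) (ord_base a)).
Local Notation tau := top_trace.
Local Notation par := (parity z).

Lemma top_traceZ k x : tau (k *: x) = k * tau x.
Proof. by rewrite /top_trace /deg2 crossedZE ext2_scaleE. Qed.

Lemma prim_at1_neq0 a : prim a 1%g != 0.
Proof.
apply/eqP=> p0; have := prim_at1 a; rewrite p0 mulr0 => /esym/eqP.
by rewrite pnatr_eq0 eqn0Ngt irr_degree_gt0.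
Qed.

Lemma top_trace_vertex a : tau (vertex_top rV a) = prim a 1%g.
Proof. by rewrite /top_trace /deg2 ffunE. Qed.

Lemma part1_id x : homogeneous1 x -> part1 x = x.
Proof.
move=> hx; apply/ffunP=> g; rewrite ffunE.
by apply: ext2P; rewrite ?(hx g).1 ?(hx g).2.
Qed.

(** The product has degree 2, where the corner is at most a line; tau gives
    the coefficient. *)
Lemma arrow_mul a b b' c x y : homogeneous1 x -> homogeneous1 y ->
    e a * x * e b = x -> e b' * y * e c = y ->
  x * y = if a == c then (tau (x * y) / prim a 1%g) *: vertex_top rV a else 0.
Proof.
move=> hx hy xE yE.
have xyE : e a * (x * y) * e c = x * y.
  by apply: corner_absorb xE yE; rewrite vertex_orth eqxx.
have [k0 [k2 [E k0E]]] := vertex_corner rV_det a c (x * y).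
rewrite xyE in E.
have p1 : part1 (x * y) = 0.
  by apply/ffunP=> g; rewrite [LHS]ffunE homogeneous1_mul // [RHS]ffunE.
rewrite p1 mulr0 mul0r addr0 in E.
have k00 : k0 = 0 by apply: k0E => g; rewrite homogeneous1_mul.
rewrite k00 scale0r add0r in E.
have [ac|nac] := eqVneq a c; last by rewrite E (negPf nac).
rewrite E ac eqxx top_traceZ top_trace_vertex mulfK //; exact: prim_at1_neq0.
Qed.

(** A generator of the degree 1 part of e_a B e_b, zero if a and b are not
    adjacent. *)
Definition simple_arrow a b : B :=
  projT1 (cid (arrow_ex (no_multiple_edges adm b a))).
Lemma simple_arrowP a b :
  [/\ homogeneous1 (simple_arrow a b),
      e a * simple_arrow a b * e b = simple_arrow a b,
      (simple_arrow a b == 0) = (m b a == 0%N)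
    & forall y, exists k, e a * part1 y * e b = k *: simple_arrow a b].
Proof. exact: projT2 (cid (arrow_ex (no_multiple_edges adm b a))). Qed.

(** Nondegeneracy of tau gives y with tau(x_ab y) <> 0; compressing y between
    e_b and e_a does not change this value, and makes it a multiple of x_ba. *)
Lemma simple_arrow_pairing a b : (0 < m a b)%N ->
  tau (simple_arrow a b * simple_arrow b a) != 0.
Proof.
move=> mab; have [hx xE x0 _] := simple_arrowP a b.
have [_ _ _ span] := simple_arrowP b a.
have nx : simple_arrow a b != 0 by rewrite x0 -lt0n (edges_sym adm).
have [y hy] := top_trace_nondeg hx nx.
have [k] := span y; rewrite part1_id // => kE.
have -> : tau (simple_arrow a b * y)
    = k * tau (simple_arrow a b * simple_arrow b a).
  rewrite -top_traceZ scalerAr -kE -{1}xE.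
  by rewrite -[e a * _ * _]mulrA -[e a * _ * _]mulrA top_traceC // !mulrA.
by rewrite mulf_eq0 negb_or => /andP[].
Qed.

(** Only the arrows leaving even vertices are rescaled: each edge has exactly
    one even end, so each pairing is normalised once, to 1 at that end and
    hence to -1 at the odd end. *)
Definition arrow a b : B :=
  if par a then simple_arrow a b
  else (tau (simple_arrow a b * simple_arrow b a))^-1 *: simple_arrow a b.

Lemma arrowP a b :
  [/\ homogeneous1 (arrow a b), e a * arrow a b * e b = arrow a b
    & exists2 k, (0 < m a b)%N -> k != 0 & arrow a b = k *: simple_arrow a b].
Proof.
have [hx xE _ _] := simple_arrowP a b.
rewrite /arrow; case: (par a); split=> //.
- by exists 1; rewrite ?scale1r // oner_neq0.
- exact: homogeneous1Z.
- by rewrite -scalerAr -scalerAl xE.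
exists (tau (simple_arrow a b * simple_arrow b a))^-1 => //.
by rewrite invr_eq0; apply: simple_arrow_pairing.
Qed.

Lemma arrow_pairing a b : (0 < m a b)%N ->
  tau (arrow a b * arrow b a) = (-1) ^+ par a.
Proof.
move=> mab; have parb := mckay_parity rV_inj rV_z mab.
have mba : (0 < m b a)%N by rewrite (edges_sym adm).
have := (simple_arrow_pairing mab, simple_arrow_pairing mba).
have [[hx _ _ _] [hy _ _ _]] := (simple_arrowP a b, simple_arrowP b a).
rewrite /arrow parb; move: (simple_arrow a b) (simple_arrow b a) hx hy.
move=> x y hx hy; case: (par a) => /= -[nab nba].
  rewrite -scalerAr top_traceZ [tau (x * y)]top_trace_anti // mulrN expr1.
  by rewrite mulVf.
by rewrite -scalerAl top_traceZ mulVf.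
Qed.

Definition loop a : B := ((-1) ^+ par a / prim a 1%g) *: vertex_top rV a.

Let Gm := ZigzagGraph adm.

Lemma mckay_system : @zigzag_system K Gm B e arrow loop.
Proof.
split.
- exact: vertex_orth.
- by move=> a b; have [] := arrowP a b.
- move=> a b c ab bc nac.
  have [hx xE _] := arrowP a b; have [hy yE _] := arrowP b c.
  by rewrite (arrow_mul hx hy xE yE) (negPf nac).
move=> a b ab; have [hx xE _] := arrowP a b; have [hy yE _] := arrowP b a.
by rewrite (arrow_mul hx hy xE yE) eqxx arrow_pairing.
Qed.

Lemma mckay_basis : @zigzag_basis K Gm B e arrow loop.
Proof.
have nz k : (-1) ^+ k != 0 :> K by rewrite signr_eq0.
split.
- move=> a x; have [k0 [k2 [E _]]] := vertex_corner rV_det a a x.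
  have [_ _ x0 span] := simple_arrowP a a; have [k kE] := span x.
  have /eqP a0 : simple_arrow a a == 0 by rewrite x0 (no_loops adm).
  move: E; rewrite kE a0.
  rewrite scaler0 addr0 eqxx => ->.
  exists k0, (k2 * (prim a 1%g / (-1) ^+ par a)); congr (_ + _).
  rewrite /loop scalerA; congr (_ *: _).
  move: (prim a 1%g) (_ ^+ _) (prim_at1_neq0 a) (nz (par a)) => p s np ns.
  by rewrite -mulrA [p / s * _]mulrA mulfVK // mulfV // mulr1.
- move=> a k1 k2 E.
  have p0 := prim_at1_neq0 a.
  have E0 : k1 * prim a 1%g = 0.
    have := congr1 (fun x : B => (x 1%g).1.1) E.
    rewrite crossedDE !crossedZE !ffunE /= !scaler0 addr0; exact.
  have E2 : k2 * ((-1) ^+ par a / prim a 1%g * prim a 1%g) = 0.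
    have := congr1 (fun x : B => (x 1%g).2) E.
    rewrite crossedDE !crossedZE !ffunE /= !scaler0 add0r; exact.
  rewrite mulfVK // in E2.
  by split; [move/eqP: E0 | move/eqP: E2];
     rewrite mulf_eq0 ?(negPf p0) ?(negPf (nz _)) orbF => /eqP.
- move=> a b x ab; have nab : a != b.
    by apply: contraTneq ab => ->; rewrite /adjacent /= (no_loops adm).
  have [k0 [k2 [E _]]] := vertex_corner rV_det a b x.
  have [_ _ _ span] := simple_arrowP a b; have [k kE] := span x.
  have [_ _ [l l0 lE]] := arrowP a b; exists (k / l).
  rewrite E (negPf nab) add0r kE lE scalerA; congr (_ *: _).
  by rewrite mulfVK // l0.
- move=> a b ab; have [_ _ [l l0 lE]] := arrowP a b.
  have [_ _ x0 _] := simple_arrowP a b.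
  rewrite lE scaler_eq0 negb_or l0 // x0 -lt0n (edges_sym adm); exact: ab.
move=> a b x nab nadj; have [k0 [k2 [E _]]] := vertex_corner rV_det a b x.
have [_ _ x0 span] := simple_arrowP a b; have [k kE] := span x.
rewrite E (negPf nab) add0r kE.
have /eqP-> : simple_arrow a b == 0; last by rewrite scaler0.
by rewrite x0 (edges_sym adm) eqn0Ngt.
Qed.

(** The McKay correspondence for the crossed product, for any finite subgroup of
    SL(2) containing -1 whose McKay graph is admissible. *)
Lemma mckay_morita : morita_equivalent B (zigzag_algebra K Gm).
Proof.
have [phi [phiM phiv phia]] := zigzag_lift mckay_system.
exact: (zigzag_morita (zpth_presentation K Gm) mckay_system mckay_basis
          phiM phiv phia (vertex_full sG rV)).
Qed.
End McKayMorita.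

(** * Finite subgroups of SU(2) *)

Theorem proposition16 (R : realType) (G : SU2_finite_subgroup R)
    (sG : irrType R[i] [set: SU2_group G])
    (G_binary : - 1%:M \in SU2_elts G)
    (G_neq : SU2_elts G <> [fset 1%:M; - 1%:M]%fset) :
  exists adm : zigzag_admissible (@mckay_edges _ _ _ sG 2 (SU2_incl G)),
    morita_equivalent (crossed (SU2_incl G))
      (zigzag_algebra R[i] (ZigzagGraph adm)).
Proof.
have V_det g : \det (SU2_incl G g) = 1 by have [] := SU2_eltsP (valP g).
have V_inj g : SU2_incl G g = 1%:M -> g = 1%g by move=> g1; apply: val_inj.
pose z : SU2_group G := FSetSub G_binary.
have V_z : SU2_incl G z = - 1%:M by [].
have big : exists g : SU2_group G, g \notin [:: 1%g; z].
  apply: contrapT => small; apply/G_neq/fsetP=> A; rewrite !inE.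
  apply/idP/idP=> [GA|/orP[]/eqP->]; [|exact: SU2_elts1|exact: G_binary].
  apply: contrapT => nA; apply: small; exists (FSetSub GA).
  apply/negP; rewrite !inE => zA; apply: nA.
  by case/orP: zA => /eqP/(congr1 val)/= ->; rewrite eqxx ?orbT.
have adm := mckay_admissible sG V_det V_inj V_z big.
by exists adm; apply: mckay_morita V_det V_inj z V_z adm.
Qed.
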